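(* Let $\mathcal{A}$ be a CQG algebra. Then each finite dimensional left-covariant first order differential $\ast$-calculus over $\mathcal{A}$ has a faithful commutator representation.
   Context: All algebras are unital and over $\mathbb{C}$; algebra homomorphisms preserve units. A CQG algebra (compact quantum group algebra) is a Hopf $\ast$-algebra which is the linear span of matrix elements of finite dimensional unitary corepresentations of it. A first order differential calculus (FODC) over $\mathcal{A}$ is an $\mathcal{A}$-bimodule $\Gamma$ with a linear mapping $d:\mathcal{A}\to\Gamma$ such that $d(ab)=a\,db+da\,b$ and $\Gamma=\mathrm{Lin}\{a\,db:\ a,b\in\mathcal{A}\}$. It is a $\ast$-calculus if there is a well-defined involution $\gamma\mapsto\gamma^\ast$ of the vector space $\Gamma$ with $(a\,db\,c)^\ast=c^\ast\, d(b^\ast)\, a^\ast$ for $a,b,c\in\mathcal{A}$. It is left-covariant if there is a linear map $\Delta_L:\Gamma\to\mathcal{A}\otimes\Gamma$ with $\Delta_L(a\,db)=\Delta(a)(\mathrm{id}\otimes d)\Delta(b)$; it is finite dimensional if the space of left-invariant elements $\{\omega:\Delta_L(\omega)=1\otimes\omega\}$ is finite dimensional. For a dense linear subspace $\mathcal{D}$ of a Hilbert space, $L(\mathcal{D})$ denotes the linear mappings of $\mathcal{D}$ into itself. A $\ast$-representation of $\mathcal{A}$ on the domain $\mathcal{D}$ is an algebra homomorphism $\pi:\mathcal{A}\to L(\mathcal{D})$ with $\langle\pi(a)\varphi,\psi\rangle=\langle\varphi,\pi(a^\ast)\psi\rangle$ for $\varphi,\psi\in\mathcal{D}$, $a\in\mathcal{A}$.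 A pair $(\pi,F)$ of a $\ast$-representation $\pi$ of $\mathcal{A}$ on a domain $\mathcal{D}$ and a symmetric linear operator $F\in L(\mathcal{D})$ is a commutator representation of a $\ast$-calculus $\Gamma$ over $\mathcal{A}$ if there is a (well-defined) linear mapping $\tau:\Gamma\to L(\mathcal{D})$ with $\tau(a\,db)=i\pi(a)(F\pi(b)-\pi(b)F)$ for all $a,b\in\mathcal{A}$. It is faithful if $\tau$ is injective. *)

(* Defs.v *)
From HB Require Import structures.
From mathcomp Require Import all_boot all_order all_algebra.
From mathcomp Require Import all_classical all_reals all_analysis.
From mathcomp Require Export complex.

Set Implicit Arguments.
Unset Strict Implicit.
Unset Printing Implicit Defensive.

Import Order.TTheory GRing.Theory Num.Theory.
Import numFieldNormedType.Exports.

Local Open Scope classical_set_scope.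
Local Open Scope ring_scope.
Local Open Scope quotient_scope.

Section LinearSpan.
Variables (K : fieldType) (V : lmodType K).

Definition lin_span (E : set V) : set V :=
  [set v | exists (n : nat) (c : 'I_n -> K) (x : 'I_n -> V),
     (forall i, E (x i)) /\ v = \sum_(i < n) c i *: x i].

(* For a linear subspace S: S is finite dimensional. *)
Definition finite_dim (S : set V) :=
  exists (n : nat) (x : 'I_n -> V),
    (forall i, S (x i)) /\ S `<=` lin_span (range x).

End LinearSpan.

(* The tensor product of K-modules: finite formal sums of pairs (u, v),
   represented by lists, modulo the congruence generated by bilinearity. *)
Section Tensor.
Variables (K : comNzRingType) (U V : lmodType K).

Inductive tensor_rel : seq (U * V) -> seq (U * V) -> Prop :=
| tr_refl s : tensor_rel s s
| tr_sym s t : tensor_rel s t -> tensor_rel t s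
| tr_trans s t w : tensor_rel s t -> tensor_rel t w -> tensor_rel s w
| tr_cat s s' t t' :
    tensor_rel s s' -> tensor_rel t t' -> tensor_rel (s ++ t) (s' ++ t')
| tr_catC s t : tensor_rel (s ++ t) (t ++ s)
| tr_addl u u' v : tensor_rel [:: (u + u', v)] [:: (u, v); (u', v)]
| tr_addr u v v' : tensor_rel [:: (u, v + v')] [:: (u, v); (u, v')]
| tr_scale c u v : tensor_rel [:: (c *: u, v)] [:: (u, c *: v)]
| tr_zero v : tensor_rel [:: (0, v)] [::].

Definition tensor_relb : rel (seq (U * V)) := fun s t => `[< tensor_rel s t >].

Lemma tensor_relb_refl : reflexive tensor_relb.
Proof. by move=> s; apply/asboolP; exact: tr_refl. Qed.

Lemma tensor_relb_sym : symmetric tensor_relb.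
Proof. by move=> s t; apply/asboolP/asboolP; exact: tr_sym. Qed.

Lemma tensor_relb_trans : transitive tensor_relb.
Proof.
by move=> t s w /asboolP st /asboolP tw; apply/asboolP; exact: tr_trans tw.
Qed.

Canonical tensor_equiv :=
  EquivRel tensor_relb tensor_relb_refl tensor_relb_sym tensor_relb_trans.

Definition tensor := {eq_quot tensor_equiv}.

HB.instance Definition _ := Choice.on tensor.
HB.instance Definition _ := EqQuotient.on tensor.

Definition tclass (s : seq (U * V)) : tensor := \pi_tensor s.

Lemma tclass_eq s t : tensor_rel s t -> tclass s = tclass t.
Proof. by move=> st; apply/eqmodP/asboolP. Qed.

Lemma tclass_inj s t : tclass s = tclass t -> tensor_rel s t.
Proof. by move=> /eqmodP/asboolP. Qed.

Lemma tclass_repr (x : tensor) : tclass (repr x) = x.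
Proof. exact: reprK. Qed.

Definition tadd (x y : tensor) : tensor := tclass (repr x ++ repr y).
Definition topp (x : tensor) : tensor :=
  tclass [seq (- p.1, p.2) | p <- repr x].
Definition tscale (c : K) (x : tensor) : tensor :=
  tclass [seq (c *: p.1, p.2) | p <- repr x].

Lemma repr_tclass s : tensor_rel (repr (tclass s)) s.
Proof. by apply: tclass_inj; rewrite tclass_repr. Qed.

Lemma tadd_class s t : tadd (tclass s) (tclass t) = tclass (s ++ t).
Proof. by apply: tclass_eq; apply: tr_cat; exact: repr_tclass. Qed.

Lemma tensor_rel_scale c s t : tensor_rel s t ->
  tensor_rel [seq (c *: p.1, p.2) | p <- s] [seq (c *: p.1, p.2) | p <- t].
Proof.
elim=> {s t} [s|s t _|s t w _ + _|s s' t t' _ + _|s t|u u' v|u v v'|k u v|v] /=.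
- exact: tr_refl.
- exact: tr_sym.
- exact: tr_trans.
- by rewrite !map_cat; exact: tr_cat.
- by rewrite !map_cat; exact: tr_catC.
- by rewrite scalerDr; exact: tr_addl.
- exact: tr_addr.
- by rewrite scalerA mulrC -scalerA; exact: tr_scale.
- by rewrite scaler0; exact: tr_zero.
Qed.

Lemma tscale_class c s :
  tscale c (tclass s) = tclass [seq (c *: p.1, p.2) | p <- s].
Proof. by apply: tclass_eq; apply: tensor_rel_scale; exact: repr_tclass. Qed.

Lemma topp_scale x : topp x = tscale (-1) x.
Proof. by congr tclass; apply: eq_map => p; rewrite scaleN1r. Qed.

Lemma taddA : associative tadd.
Proof.
move=> x y z; rewrite -(tclass_repr x) -(tclass_repr y) -(tclass_repr z).
by rewrite !tadd_class catA.
Qed.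

Lemma taddC : commutative tadd.
Proof. by move=> x y; apply: tclass_eq; exact: tr_catC. Qed.

Lemma tadd0 : left_id (tclass [::]) tadd.
Proof. by move=> x; rewrite -(tclass_repr x) tadd_class. Qed.

Lemma tscaleDl x : {morph tscale^~ x : a b / a + b >-> tadd a b}.
Proof.
move=> a b; rewrite -(tclass_repr x) !tscale_class tadd_class.
apply: tclass_eq; elim: (repr x) => [|p s IHs] /=; first exact: tr_refl.
apply: (@tr_trans _ ([:: (a *: p.1, p.2); (b *: p.1, p.2)] ++
   ([seq (a *: p.1, p.2) | p <- s] ++ [seq (b *: p.1, p.2) | p <- s]))).
  rewrite -cat1s; apply: tr_cat => //.
  by rewrite scalerDl; exact: tr_addl.
have := tr_cat (tr_catC [:: (b *: p.1, p.2)] [seq (a *: p.1, p.2) | p <- s])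
  (tr_refl [seq (b *: p.1, p.2) | p <- s]).
by rewrite -[X in tensor_rel _ X]catA; exact: tr_cat (tr_refl [:: _]).
Qed.

Lemma tscale0 x : tscale 0 x = tclass [::].
Proof.
rewrite -(tclass_repr x) tscale_class; apply: tclass_eq.
elim: (repr x) => [|p s IHs] /=; first exact: tr_refl.
rewrite -cat1s -[X in tensor_rel _ X]/([::] ++ [::]); apply: tr_cat => //.
by rewrite scale0r; exact: tr_zero.
Qed.

Lemma tscale1 : left_id 1 tscale.
Proof.
move=> x; rewrite -[RHS]tclass_repr; congr tclass.
by rewrite -[RHS]map_id; apply: eq_map => -[u v]; rewrite scale1r.
Qed.

Lemma taddN : left_inverse (tclass [::]) topp tadd.
Proof.
by move=> x; rewrite topp_scale -{2}(tscale1 x) -tscaleDl addNr tscale0.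
Qed.

HB.instance Definition _ := GRing.isZmodule.Build tensor taddA taddC tadd0 taddN.

Lemma tscaleA a b x : tscale a (tscale b x) = tscale (a * b) x.
Proof.
rewrite -(tclass_repr x) !tscale_class -map_comp; congr tclass.
by apply: eq_map => p /=; rewrite scalerA.
Qed.

Lemma tscaleDr : right_distributive tscale +%R.
Proof.
move=> c x y; rewrite -(tclass_repr x) -(tclass_repr y).
rewrite [in LHS]/GRing.add /= tadd_class !tscale_class.
by rewrite [in RHS]/GRing.add /= tadd_class map_cat.
Qed.

HB.instance Definition _ :=
  GRing.Zmodule_isLmodule.Build K tensor tscaleA tscale1 tscaleDr tscaleDl.

Definition tpure (u : U) (v : V) : tensor := tclass [:: (u, v)].

Lemma tclass_sum s : tclass s = \sum_(p <- s) tpure p.1 p.2.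
Proof.
elim: s => [|p s IHs]; first by rewrite big_nil.
by rewrite big_cons -IHs [RHS]/GRing.add /= tadd_class; case: p {IHs}.
Qed.

Lemma tensor_sum (x : tensor) : x = \sum_(p <- repr x) tpure p.1 p.2.
Proof. by rewrite -tclass_sum tclass_repr. Qed.

(* The additive map on the tensor product induced by a balanced map f, by
   tlift_tpure and tlift_zmod_morphism. It depends on the representative of x
   if f is not balanced, so every f it is used with below is balanced. *)
Definition tlift (W : zmodType) (f : U -> V -> W) (x : tensor) : W :=
  \sum_(p <- repr x) f p.1 p.2.

Definition balanced (W : zmodType) (f : U -> V -> W) :=
  [/\ forall u u' v, f (u + u') v = f u v + f u' v,
      forall u v v', f u (v + v') = f u v + f u v' &
      forall c u v, f (c *: u) v = f u (c *: v)].

Lemma tlift_class (W : zmodType) (f : U -> V -> W) s : balanced f ->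
  tlift f (tclass s) = \sum_(p <- s) f p.1 p.2.
Proof.
case=> fDl fDr fZ; rewrite /tlift.
have := repr_tclass s; move: (repr _) => r; elim=> {r s} [//|s t _ -> //|s t w _ -> _ -> //|s s' t t' _ + _ +|s t|u u' v|
            u v v'|c u v|v].
- by rewrite !big_cat /= => -> ->.
- by rewrite !big_cat /= addrC.
- by rewrite !big_cons !big_nil /= !addr0 fDl.
- by rewrite !big_cons !big_nil /= !addr0 fDr.
- by rewrite !big_cons !big_nil /= !addr0 fZ.
- rewrite big_cons !big_nil /= addr0.
  by apply: (addrI (f 0 v)); rewrite -fDl !addr0.
Qed.

Lemma tlift_tpure (W : zmodType) (f : U -> V -> W) u v : balanced f ->
  tlift f (tpure u v) = f u v.
Proof. by move=> bf; rewrite tlift_class // big_cons big_nil addr0. Qed.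

Lemma tliftD (W : zmodType) (f : U -> V -> W) : balanced f ->
  {morph tlift f : x y / x + y}.
Proof.
move=> bf x y; rewrite -(tclass_repr x) -(tclass_repr y).
by rewrite [in LHS]/GRing.add /= tadd_class !tlift_class // big_cat.
Qed.

Lemma tlift_zmod_morphism (W : zmodType) (f : U -> V -> W) : balanced f ->
  zmod_morphism (tlift f).
Proof.
move=> bf x y; apply: (addIr (tlift f y)).
by rewrite -tliftD // !subrK.
Qed.

Lemma tliftZ (W : lmodType K) (f : U -> V -> W) : balanced f ->
  (forall c u v, f (c *: u) v = c *: f u v) ->
  forall c x, tlift f (c *: x) = c *: tlift f x.
Proof.
move=> bf fZ c x; rewrite -(tclass_repr x).
rewrite [in LHS]/GRing.scale /= tscale_class !tlift_class // big_map scaler_sumr.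
by apply: eq_bigr => p _ /=; rewrite fZ.
Qed.

Lemma tpure_balanced : balanced tpure.
Proof.
split=> [u u' v|u v v'|c u v].
- by rewrite [RHS]/GRing.add /= tadd_class; apply: tclass_eq; exact: tr_addl.
- by rewrite [RHS]/GRing.add /= tadd_class; apply: tclass_eq; exact: tr_addr.
- by apply: tclass_eq; exact: tr_scale.
Qed.

Lemma tpureZl c u v : tpure (c *: u) v = c *: tpure u v.
Proof. by rewrite [RHS]/GRing.scale /= tscale_class. Qed.

End Tensor.

Notation "u ⊗ v" := (tpure u v) (at level 40, left associativity) : ring_scope.

Section TensorMaps.
Variable K : comNzRingType.

Definition tmap (U U' V V' : lmodType K) (f : U -> U') (g : V -> V')
  : tensor U V -> tensor U' V' := tlift (fun u v => f u ⊗ g v).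

Definition tassoc (U V W : lmodType K) : tensor (tensor U V) W -> tensor U (tensor V W) :=
  tlift (fun x w => tlift (fun u v => u ⊗ (v ⊗ w)) x).

(* (a ⊗ u) (b ⊗ v) = f a b ⊗ g u v *)
Definition tmul2 (U U' U'' V V' V'' : lmodType K)
    (f : U -> U' -> U'') (g : V -> V' -> V'')
    (x : tensor U V) (y : tensor U' V') : tensor U'' V'' :=
  tlift (fun u v => tlift (fun u' v' => f u u' ⊗ g v v') y) x.

End TensorMaps.

Section HopfStar.
Variables (C : numClosedFieldType).

Definition antilinear (V W : lmodType C) (f : V -> W) :=
  forall (k : C) (x y : V), f (k *: x + y) = k^* *: f x + f y.

Record hopf_star_algebra (A : algType C) := HopfStarAlgebra {
  comul : {linear A -> tensor A A};
  counit : {linear A -> C^o};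
  antipode : {linear A -> A};
  star : A -> A;
  coassoc : forall a,
    tassoc (tmap comul id (comul a)) = tmap id comul (comul a);
  counit_comull : forall a, tlift (fun x y => counit x *: y) (comul a) = a;
  counit_comulr : forall a, tlift (fun x y => counit y *: x) (comul a) = a;
  comulM : forall a b,
    comul (a * b) = tmul2 *%R *%R (comul a) (comul b);
  comul1 : comul 1 = 1 ⊗ 1;
  counitM : forall a b, counit (a * b) = counit a * counit b;
  counit1 : counit 1 = 1;
  antipodel : forall a,
    tlift (fun x y => antipode x * y) (comul a) = (counit a : C)%:A;
  antipoder : forall a,
    tlift (fun x y => x * antipode y) (comul a) = (counit a : C)%:A;
  star_antilinear : antilinear star;
  starK : involutive star;
  starM : forall a b, star (a * b) = star b * star a;
  comul_star : forall a, comul (star a) = tmap star star (comul a)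
}.

Variables (A : algType C) (H : hopf_star_algebra A).

(* A finite dimensional unitary corepresentation, given by its matrix with
   respect to an orthonormal basis of the n-dimensional Hilbert space. *)
Definition unitary_corep (n : nat) (v : 'M[A]_n) :=
  let vstar := map_mx (star H) v^T in
  [/\ forall i j, comul H (v i j) = \sum_(k < n) v i k ⊗ v k j,
      forall i j, counit H (v i j) = (i == j)%:R,
      v *m vstar = 1%:M & vstar *m v = 1%:M].

Definition is_CQG :=
  lin_span [set a | exists (n : nat) (v : 'M[A]_n) (i j : 'I_n),
                      unitary_corep v /\ a = v i j] = [set: A].

End HopfStar.

Section Calculus.
Variables (C : numClosedFieldType) (A : algType C).

Record bimodule (G : lmodType C) := Bimodule {
  lact : {bilinear A -> G -> G};
  ract : {bilinear G -> A -> G};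
  lact1 : forall g, lact 1 g = g;
  lactM : forall a b g, lact (a * b) g = lact a (lact b g);
  ract1 : forall g, ract g 1 = g;
  ractM : forall g a b, ract g (a * b) = ract (ract g a) b;
  lractA : forall a g b, ract (lact a g) b = lact a (ract g b)
}.

Record fodc (G : lmodType C) := FODC {
  fodc_bimod :> bimodule G;
  fodc_d : {linear A -> G};
  fodc_leibniz : forall a b, fodc_d (a * b) =
    lact fodc_bimod a (fodc_d b) + ract fodc_bimod (fodc_d a) b;
  fodc_span :
    lin_span [set g | exists a b, g = lact fodc_bimod a (fodc_d b)] = [set: G]
}.

Variables (H : hopf_star_algebra A) (G : lmodType C) (Gam : fodc G).

Definition is_star_calculus :=
  exists st : G -> G,
    [/\ antilinear st, involutive st &
        forall a b c,
          st (ract Gam (lact Gam a (fodc_d Gam b)) c) =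
          ract Gam (lact Gam (star H c) (fodc_d Gam (star H b))) (star H a)].

(* The product of Delta(a) with an element of A ⊗ G is taken with respect to
   the left action (x ⊗ y) (b ⊗ g) = x b ⊗ y g. *)
Definition is_left_coaction (DL : {linear G -> tensor A G}) :=
  forall a b, DL (lact Gam a (fodc_d Gam b)) =
    tmul2 *%R (lact Gam) (comul H a) (tmap id (fodc_d Gam) (comul H b)).

Definition left_invariant (DL : {linear G -> tensor A G}) : set G :=
  [set w | DL w = 1 ⊗ w].

(* Delta_L is unique when it exists, as G is spanned by the elements a db. *)
Definition finite_dim_left_covariant :=
  exists DL : {linear G -> tensor A G},
    is_left_coaction DL /\ finite_dim (left_invariant DL).

End Calculus.

Section Domain.
Variables (C : numClosedFieldType) (V : completeNormedModType C).

Definition dom (D : submodClosed V) := {x : V | x \in D}.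

Variable D : submodClosed V.
HB.instance Definition _ := SubType.on (dom D).
HB.instance Definition _ := Choice.on (dom D).
HB.instance Definition _ := [SubChoice_isSubLmodule of dom D by <:].

End Domain.

Section Representation.
Variables (C : numClosedFieldType).

(* The inner product induces the norm of the Banach space V, which thereby
   is a Hilbert space; ip is linear in its first argument. *)
Definition is_hilbert (V : completeNormedModType C) (ip : {dot V for Num.conj}) :=
  forall x : V, `|x| ^+ 2 = ip x x.

Variables (V : completeNormedModType C) (ip : {dot V for Num.conj}).
Variable D : submodClosed V.

(* L(D) is the type {linear dom D -> dom D}. *)
Definition symmetric_op (F : {linear dom D -> dom D}) :=
  forall x y : dom D, ip (val (F x)) (val y) = ip (val x) (val (F y)).

Variables (A : algType C) (H : hopf_star_algebra A).

Definition is_star_rep (rep : A -> {linear dom D -> dom D}) :=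
  [/\ forall k a b x, rep (k *: a + b) x = k *: rep a x + rep b x,
      forall x, rep 1 x = x,
      forall a b x, rep (a * b) x = rep a (rep b x) &
      forall a x y,
        ip (val (rep a x)) (val y) = ip (val x) (val (rep (star H a) y))].

Variables (G : lmodType C) (Gam : fodc A G).

Definition is_commutator_map (rep : A -> {linear dom D -> dom D})
    (F : {linear dom D -> dom D}) (tau : G -> {linear dom D -> dom D}) :=
  (forall k g g' x, tau (k *: g + g') x = k *: tau g x + tau g' x) /\
  (forall a b x, tau (lact Gam a (fodc_d Gam b)) x =
                 'i *: rep a (F (rep b x) - rep b (F x))).

(* tau is unique when it exists, as G is spanned by the elements a db. *)
Definition faithful_commutator_rep (rep : A -> {linear dom D -> dom D})
    (F : {linear dom D -> dom D}) :=
  exists tau : G -> {linear dom D -> dom D},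
    is_commutator_map rep F tau /\
    (forall g g', tau g =1 tau g' -> g = g').

End Representation.

(* Main.v *)
Require Import Defs.
From HB Require Import structures.
From mathcomp Require Import all_boot all_order all_algebra.
From mathcomp Require Import all_classical all_reals all_analysis.
From mathcomp Require Import complex ring.

(** Let T be a left A-linear map from the calculus G to A, and put F = T o d.  By
    the Leibniz rule F (c b) - c (F b) = T (dc b), so the commutator of F with left
    multiplication by c is the operator b |-> T (dc b).  Therefore
    tau g : b |-> 'i T (g b) is defined on all of G and is the commutator map of F
    and the left multiplication of A; at b = 1 it returns 'i T g.  So it suffices
    to find finitely many T that together separate the points of G, and an inner
    product on A for which left multiplication is a star-representation and all
    T o d are symmetric.  The direct sum of the corresponding copies of A, completed
    to a Hilbert space (hilbert_completion), then carries the representation.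

    The inner product is h (star c * b), with h the Haar functional.  On the
    coefficients of a unitary corepresentation v, h is given by the orthogonal
    projection on the fixed vectors of v.  It is well defined because projectors
    on subspaces that are invariant under all matrices f (v) commute with these
    matrices (invariant_projector, haar_mx_coef0).  It is positive definite
    (haar_positive) because its Gram matrices commute with the corepresentation:
    on an eigenspace the form is a multiple lam of a standard inner product, and
    the sign of lam can be read off from a single sum of the form star b * b that
    unitarity evaluates to a positive constant (gram_eigen_gt0).

    The maps T come from left covariance.  The forms omega a = S(a1) d(a2) are
    left-invariant and generate G, so contraction of the invariant part of a form
    with a functional phi gives a left A-linear map (contract).  Composed with d
    it is the convolution operator a |-> a1 phi(omega a2), whose adjoint is
    convolution by another functional.  The involution of G shows that this
    adjoint is again a contraction composed with d, for the functional dagger phi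
    (contract_adjoint).  Contractions by functionals that dagger fixes are thus
    symmetric, and finitely many of them separate the points of G because the
    left-invariant forms have finite dimension (separating_contractions). *)

Set Implicit Arguments.
Unset Strict Implicit.
Unset Printing Implicit Defensive.

Import Order.TTheory GRing.Theory Num.Theory.
Import numFieldNormedType.Exports.
Local Open Scope classical_set_scope.
Local Open Scope sesquilinear_scope.
Local Open Scope ring_scope.
Local Notation conjC := Num.conj.

(** * Linear functionals *)

Section Functionals.
Variables (K : fieldType) (V : lmodType K).

Definition functional_of (f : V -> K) (Hf : scalar f) : {scalar V} :=
  HB.pack f (GRing.isLinear.Build K V K *%R f Hf).

Definition subspace (S : set V) :=
  S 0 /\ forall k x y, S x -> S y -> S (k *: x + y).

Lemma subspaceB (S : set V) x y : subspace S -> S x -> S y -> S (x - y).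
Proof. by case=> _ SD Sx Sy; rewrite addrC -scaleN1r; apply: SD. Qed.

Lemma subspaceZ (S : set V) k x : subspace S -> S x -> S (k *: x).
Proof. by case=> S0 SD Sx; rewrite -[_ *: _]addr0; apply: SD. Qed.

Lemma subspace_sum (S : set V) I (r : seq I) (P : pred I) (F : I -> V) :
  subspace S -> (forall i, P i -> S (F i)) -> S (\sum_(i <- r | P i) F i).
Proof.
case=> S0 SD SF; elim/big_ind: _ => // x y Sx Sy.
by rewrite -[x]scale1r; apply: SD.
Qed.

(** By Zorn's lemma there is a subspace M maximal among those that miss x.
    Adjoining any further vector to M captures x, so M and x together span V,
    and the coefficient of x modulo M is the functional. *)
Lemma functional_sep (x : V) : x != 0 -> exists f : {scalar V}, f x = 1.
Proof.
move=> x0.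
pose P S := subspace S /\ ~ S x.
have Pchain (F : set (set V)) : F `<=` P -> total_on F subset ->
    (exists S, F S) -> P (\bigcup_(X in F) X).
  move=> FP Ftot [S0 FS0]; split; last by case=> S /FP[].
  split; first by exists S0 => //; case: (FP _ FS0) => -[].
  move=> k y z [S FS Sy] [T FT Tz].
  have [ST|TS] := Ftot _ _ FS FT.
    by exists T => //; have [[_ TD] _] := FP _ FT; apply: TD => //; exact: ST.
  by exists S => //; have [[_ SD] _] := FP _ FS; apply: SD => //; exact: TS.
(* The empty set is admitted because it is the union of the empty chain. *)
pose Q S := S = set0 \/ P S.
have [M [QM Mmax]] : exists A, Q A /\ forall B, A `<` B -> ~ Q B.
  apply: Zorn_bigcup => F FQ Ftot.
  have [[S [FS PS]]|noP] := pselect (exists S, F S /\ P S); last first.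
    left; apply/seteqP; split=> // y [S FS Sy].
    by have [S0|PS] := FQ _ FS; [rewrite -S0|case: noP; exists S].
  right; have -> : \bigcup_(X in F) X = \bigcup_(X in F `&` P) X.
    apply/seteqP; split=> y [T]; last by case=> FT _ Ty; exists T.
    by move=> FT Ty; have [T0|PT] := FQ _ FT; [rewrite T0 in Ty|exists T].
  apply: Pchain; first by move=> T [].
    by move=> T U [FT _] [FU _]; apply: Ftot.
  by exists S.
have P0 : P [set 0].
  split; last by move=> /= x0'; rewrite x0' eqxx in x0.
  by split=> // k y z -> ->; rewrite scaler0 addr0.
have {QM} [Ms Mx] : P M.
  case: QM => // M0; case: (Mmax [set 0]); last by right.
  by rewrite M0; split=> // /(_ 0); apply.
have dec y : exists c, M (y - c *: x).
  have [My|nMy] := pselect (M y); first by exists 0; rewrite scale0r subr0.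
  pose N : set V := [set z | exists k, M (z - k *: y)].
  have Ns : subspace N.
    split; first by exists 0; rewrite scale0r subr0; case: Ms.
    move=> k u v [a Ma] [b Mb]; exists (k * a + b).
    have := Ms.2 k _ _ Ma Mb.
    by rewrite scalerBr scalerA addrACA -opprD -scalerDl.
  have Nx : N x.
    apply: contrapT => Nx; apply: (Mmax N); last by right.
    split; last by move=> NM; apply: nMy; apply: NM; exists 1;
      rewrite scale1r subrr; case: Ms.
    by move=> z Mz; exists 0; rewrite scale0r subr0.
  case: Nx => k Mk.
  have k0 : k != 0 by apply/eqP => k0; rewrite k0 scale0r subr0 in Mk.
  exists k^-1; have := subspaceZ (- k^-1) Ms Mk.
  by rewrite scalerBr !scaleNr scalerA mulVf // scale1r opprK addrC.
have uniq y c d : M (y - c *: x) -> M (y - d *: x) -> c = d.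
  move=> Mc Md; apply/eqP; rewrite -subr_eq0; apply/negPn/negP => cd.
  have := subspaceB Ms Md Mc.
  have -> : y - d *: x - (y - c *: x) = (c - d) *: x.
    by rewrite opprB addrC addrA subrK scalerBl.
  by move/(subspaceZ (c - d)^-1 Ms); rewrite scalerA mulVf // scale1r.
pose f y := projT1 (cid (dec y)).
have fP y : M (y - f y *: x) by rewrite /f; case: cid.
have fs : scalar f.
  move=> k y z; apply: (uniq (k *: y + z)) => //.
  have := Ms.2 k _ _ (fP y) (fP z).
  by rewrite scalerBr scalerA addrACA -opprD -scalerDl.
exists (functional_of fs); apply: (uniq x) => //.
by rewrite scale1r subrr; case: Ms.
Qed.

Lemma functional_inj (x y : V) : (forall f : {scalar V}, f x = f y) -> x = y.
Proof.
move=> fxy; apply/eqP; rewrite -subr_eq0; apply/negPn/negP => /functional_sep[f].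
by rewrite raddfB /= fxy subrr => /esym/eqP; rewrite oner_eq0.
Qed.

End Functionals.

Section Biorthogonal.
Variables (K : fieldType) (V : lmodType K).

Lemma lin_span_range n (x : 'I_n -> V) v : lin_span (range x) v ->
  exists d : 'I_n -> K, v = \sum_(k < n) d k *: x k.
Proof.
case=> m [c [y [yx ->]]].
have /choice[k kP] : forall i, exists k, y i = x k.
  by move=> i; have [k _ <-] := yx i; exists k.
exists (fun j => \sum_(i < m | k i == j) c i).
rewrite (partition_big k predT) //=; apply: eq_bigr => j _.
by rewrite scaler_suml; apply: eq_bigr => i /eqP <-; rewrite kP.
Qed.

(** A biorthogonal system in S has at most n members, because the identity matrix
    of its pairings factors through the n coordinates on x.  In a system of
    maximal length every s is recovered from its coordinates: a functional that
    separates the residue of s from 0 would prolong the system.  This turns the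
    finite dimension of a space of forms into finitely many functionals that are
    defined on all forms. *)
Lemma biorthogonal_system n (x : 'I_n -> V) (S : set V) :
  subspace S -> S `<=` lin_span (range x) ->
  exists r (e : 'I_r -> V) (phi : 'I_r -> {scalar V}),
    [/\ forall i, S (e i), forall i j, phi i (e j) = (i == j)%:R &
        forall s, S s -> s = \sum_i phi i s *: e i].
Proof.
move=> Ss Sx.
pose P r := `[< exists (e : 'I_r -> V) (phi : 'I_r -> {scalar V}),
  (forall i, S (e i)) /\ (forall i j, phi i (e j) = (i == j)%:R) >].
have exP : exists r, P r.
  exists 0; apply/asboolP; exists (fun=> 0).
  have zs : scalar (fun _ : V => 0 : K) by move=> k u w /=; rewrite mulr0 addr0.
  by exists (fun=> functional_of zs); split; case.
have Pn r : P r -> (r <= n)%N.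
  move=> /asboolP[e [phi [Se pe]]].
  have /choice[d dP] : forall j, exists d : 'I_n -> K, e j = \sum_(k < n) d k *: x k.
    by move=> j; apply/lin_span_range/Sx.
  pose M := \matrix_(j < r, k < n) d j k.
  pose N := \matrix_(k < n, i < r) phi i (x k).
  have MN : M *m N = 1%:M.
    apply/matrixP => j i; rewrite !mxE eq_sym -pe dP raddf_sum.
    by apply: eq_bigr => k _; rewrite !mxE /= linearZ.
  by rewrite -[r](mxrank1 K) -MN (leq_trans (mxrankM_maxl _ _)) // rank_leq_col.
have [r /asboolP[e [phi [Se pe]]] rmax] := ex_maxnP exP Pn.
exists r, e, phi; split=> // s Ss'.
apply/eqP; rewrite -subr_eq0; apply/negPn/negP.
set w := _ - _ => w0; have [psi psiw] := functional_sep w0.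
have Sw : S w.
  by apply: subspaceB => //; apply: subspace_sum => // i _; apply: subspaceZ.
have phiw i : phi i w = 0.
  rewrite raddfB /= raddf_sum (bigD1 i) //= linearZ /= pe eqxx mulr1.
  rewrite big1 ?addr0 ?subrr // => j ji.
  by rewrite linearZ /= pe eq_sym (negbTE ji) mulr0.
have chis : scalar (fun v => psi v - \sum_i psi (e i) * phi i v).
  move=> k u v; rewrite linearP /= mulrBr addrACA -opprD; congr (_ - _).
  rewrite mulr_sumr -big_split; apply: eq_bigr => i _.
  by rewrite linearP /= mulrDr mulrCA.
(* chi is psi corrected so as to vanish on the e i; w already vanishes under the phi i. *)
suff /rmax : P r.+1 by rewrite ltnn.
apply/asboolP.
exists (fun i => if unlift ord0 i is Some j then e j else w).
exists (fun i => if unlift ord0 i is Some j then phi j else functional_of chis).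
split=> [i|i j]; first by case: unliftP.
case: unliftP => [i' ->|->]; case: unliftP => [j' ->|->].
- by rewrite pe (inj_eq lift_inj).
- by rewrite phiw; have /negbTE := neq_lift ord0 i'; rewrite eq_sym => ->.
- rewrite /= (bigD1 j') //= pe eqxx mulr1 big1 ?addr0 ?subrr //.
  by move=> i0 ij; rewrite pe (negbTE ij) mulr0.
- by rewrite /= psiw big1 ?subr0 ?eqxx // => i0 _; rewrite phiw mulr0.
Qed.

End Biorthogonal.

(** * Tensor products *)

Section TensorCalculus.
Variable K : comNzRingType.

Lemma tlift_sum (U V : lmodType K) (W : zmodType) (f : U -> V -> W) I (r : seq I)
    (a : I -> U) (b : I -> V) : balanced f ->
  tlift f (\sum_(i <- r) a i ⊗ b i) = \sum_(i <- r) f (a i) (b i).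
Proof.
move=> bf.
have f0 : tlift f 0 = 0.
  by have := tlift_zmod_morphism bf 0 0; rewrite !subrr.
rewrite (big_morph (tlift f) (tliftD bf) f0); apply: eq_bigr => i _.
exact: tlift_tpure.
Qed.

Lemma bilinear_balanced (U V W : lmodType K) (f : U -> V -> W) :
  bilinear_for *:%R *:%R f -> balanced f.
Proof.
case=> fl fr; split=> [u u' v|u v v'|c u v].
- by have /= := fl v 1 u u'; rewrite !scale1r.
- by have /= := fr u 1 v v'; rewrite !scale1r.
- have f0r : f u 0 = 0.
    by have /= := fr u (-1) 0 0; rewrite scaler0 addr0 scaleN1r addNr.
  have f0l : f 0 v = 0.
    by have /= := fl v (-1) 0 0; rewrite scaler0 addr0 scaleN1r addNr.
  have /= := fl v c u 0; rewrite f0l !addr0 => ->.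
  by have /= := fr u c v 0; rewrite f0r !addr0 => ->.
Qed.

Lemma tpure_bilinear (U V : lmodType K) :
  bilinear_for *:%R *:%R (fun (u : U) (v : V) => u ⊗ v).
Proof.
have [tDl tDr tZ] := @tpure_balanced K U V.
split=> [v|u] c x y /=; first by rewrite tDl tpureZl.
by rewrite tDr -tZ tpureZl.
Qed.

Lemma tmap_sum (U U' V V' : lmodType K) (f : U -> U') (g : V -> V') I (r : seq I)
    (a : I -> U) (b : I -> V) :
  balanced (fun u v => f u ⊗ g v) ->
  tmap f g (\sum_(i <- r) a i ⊗ b i) = \sum_(i <- r) f (a i) ⊗ g (b i).
Proof. exact: tlift_sum. Qed.

Lemma tmap_lin_balanced (U U' V V' : lmodType K) (f : {linear U -> U'})
  (g : {linear V -> V'}) : balanced (fun u v => f u ⊗ g v).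
Proof.
have [tl tr] := @tpure_bilinear U' V'.
by apply: bilinear_balanced; split=> [v|u] c x y; rewrite linearP ?tl ?tr.
Qed.

Lemma tmul2_sum (U U' U'' V V' V'' : lmodType K)
    (f : U -> U' -> U'') (g : V -> V' -> V'')
    I J (r : seq I) (s : seq J) (a : I -> U) (b : I -> V)
    (a' : J -> U') (b' : J -> V') :
  bilinear_for *:%R *:%R f -> bilinear_for *:%R *:%R g ->
  tmul2 f g (\sum_(i <- r) a i ⊗ b i) (\sum_(j <- s) a' j ⊗ b' j) =
  \sum_(i <- r) \sum_(j <- s) f (a i) (a' j) ⊗ g (b i) (b' j).
Proof.
move=> [fl fr] [gl gr].
have [tl tr] := @tpure_bilinear U'' V''.
have inner u v : balanced (fun u' v' => f u u' ⊗ g v v').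
  by apply: bilinear_balanced; split=> [w|w] c x y; rewrite ?fr ?gr ?tl ?tr.
rewrite /tmul2 tlift_sum; first by apply: eq_bigr => i _; rewrite tlift_sum.
apply: bilinear_balanced; split=> [w|w] c x y; rewrite /= /tlift scaler_sumr -big_split;
  by apply: eq_bigr => p _ /=; rewrite ?fl ?gl ?tl ?tr.
Qed.

End TensorCalculus.

(** * The convolution star-algebra of functionals *)

Section HopfStar.
Variables (C : numClosedFieldType) (A : algType C) (H : hopf_star_algebra A).
Local Notation S := (antipode H).
Local Notation D := (comul H).
Local Notation "a ^*" := (star H a) : ring_scope.

Lemma starP (k : C) a b : (k *: a + b)^* = conjC k *: a^* + b^*.
Proof. exact: star_antilinear. Qed.

Lemma star0 : 0^* = 0 :> A.
Proof. by have := starP (-1) 0 0; rewrite scaler0 addr0 rmorphN1 scaleN1r addNr. Qed.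

Lemma starD a b : (a + b)^* = a^* + b^*.
Proof. by have := starP 1 a b; rewrite rmorph1 !scale1r. Qed.

Lemma starZ (k : C) a : (k *: a)^* = conjC k *: a^*.
Proof. by have := starP k a 0; rewrite star0 !addr0. Qed.

Lemma star_sum I (r : seq I) (F : I -> A) :
  (\sum_(i <- r) F i)^* = \sum_(i <- r) (F i)^*.
Proof. exact: (big_morph _ starD star0). Qed.

Lemma star1 : 1^* = 1 :> A.
Proof. by rewrite -[LHS]mulr1 -{2}(starK H 1) -starM mulr1 starK. Qed.

Lemma antipode1 : S 1 = 1.
Proof.
have := antipodel H 1; rewrite comul1 counit1 scale1r tlift_tpure ?mulr1 //.
by split=> *; rewrite ?linearD ?mulrDl ?mulrDr // linearZ -scalerAl -scalerAr.
Qed.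

Lemma star_balanced : balanced (fun a b : A => a^* ⊗ b^*).
Proof.
have [tDl tDr tZ] := @tpure_balanced C A A.
by split=> *; rewrite ?starD ?tDl ?tDr // !starZ tZ.
Qed.

Lemma comul_star_sum I (r : seq I) (a b : I -> A) c :
  D c = \sum_(i <- r) a i ⊗ b i -> D c^* = \sum_(i <- r) (a i)^* ⊗ (b i)^*.
Proof. by rewrite comul_star => ->; apply: tmap_sum; exact: star_balanced. Qed.

Lemma mul_bilinear : bilinear_for *:%R *:%R ( *%R : A -> A -> A).
Proof.
by split=> a k x y /=; rewrite ?mulrDl ?mulrDr -?scalerAl -?scalerAr.
Qed.

Lemma comulM_sum I J (r : seq I) (s : seq J) (a b : I -> A) (a' b' : J -> A) c c' :
  D c = \sum_(i <- r) a i ⊗ b i -> D c' = \sum_(j <- s) a' j ⊗ b' j ->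
  D (c * c') = \sum_(i <- r) \sum_(j <- s) (a i * a' j) ⊗ (b i * b' j).
Proof.
by move=> Dc Dc'; rewrite comulM Dc Dc'; apply: tmul2_sum; exact: mul_bilinear.
Qed.

Lemma conv_balanced (f g : {scalar A}) : balanced (fun x y => f x * g y).
Proof.
by split=> *; rewrite ?linearD ?mulrDl ?mulrDr // !linearZ /= mulrCA mulrA.
Qed.

Lemma conv_scalar (f g : {scalar A}) :
  scalar (fun a => tlift (fun x y => f x * g y) (D a)).
Proof.
have fg := conv_balanced f g.
move=> k a b; rewrite linearP tliftD //; congr (_ + _).
apply: (@tliftZ C A A C^o) => // c u v.
by rewrite linearZ /= -mulrA.
Qed.

Definition conv f g := functional_of (conv_scalar f g).

Lemma sharp_scalar (f : {scalar A}) : scalar (fun a => conjC (f (S a)^*)).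
Proof.
move=> k a b; rewrite linearP starP linearP /= rmorphD rmorphM /=.
by rewrite conjCK.
Qed.

(** The involution of the dual star-algebra; see fmx_sharp. *)
Definition sharp f := functional_of (sharp_scalar f).

Lemma counit_scalar : scalar (counit H : A -> C).
Proof. by move=> k a b; rewrite linearP. Qed.

Definition epsilon := functional_of counit_scalar.

Lemma sharp1 f : sharp f 1 = conjC (f 1).
Proof. by rewrite /= antipode1 star1. Qed.

End HopfStar.

(** * Orthogonal projections of column spaces *)

Section OrthogonalProjection.
Variable C : numClosedFieldType.

Lemma mulmx_colP m n (M N : 'M[C]_(m, n)) :
  (forall x : 'cV_n, M *m x = N *m x) -> M = N.
Proof.
move=> MN; apply/matrixP => i j.
by have /colP/(_ i) := MN (delta_mx j 0); rewrite -!colE !mxE.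
Qed.

Lemma adjmxM m n p (M : 'M[C]_(m, n)) (N : 'M[C]_(n, p)) :
  (M *m N)^t* = N^t* *m M^t*.
Proof. by rewrite trmx_mul map_mxM. Qed.

(** A matrix of maximal rank among those whose rows lie in Z has row space Z, as a
    missing vector could be adjoined to it. *)
Lemma subspace_rowspan n (Z : set 'cV[C]_n) : subspace Z ->
  exists U : 'M[C]_n, forall x : 'cV_n, Z x <-> (x^T <= U)%MS.
Proof.
move=> Zs.
pose P r := `[< exists U : 'M[C]_n,
  (forall x : 'rV_n, (x <= U)%MS -> Z x^T) /\ \rank U = r >].
have exP : exists r, P r.
  exists 0%N; apply/asboolP; exists 0; split; last by rewrite mxrank0.
  by move=> x; rewrite submx0 => /eqP ->; rewrite trmx0; case: Zs.
have Pn r : P r -> (r <= n)%N by move=> /asboolP[U [_ <-]]; exact: rank_leq_row.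
have [r /asboolP[U [UZ Ur]] rmax] := ex_maxnP exP Pn.
exists U => x; split; last by move/UZ; rewrite trmxK.
move=> Zx; apply/negPn/negP => xU.
suff /rmax : P (\rank (U + x^T)%MS).
  rewrite -Ur => le; case/negP: xU.
  apply: submx_trans (addsmxSr U _) _.
  by rewrite -(mxrank_leqif_sup (addsmxSl U x^T)).2 eqn_leq le mxrankS ?addsmxSl.
apply/asboolP; exists (U + x^T)%MS; split=> // y /sub_addsmxP[[a b] /= ->].
rewrite linearD /= addrC [b]mx11_scalar mul_scalar_mx linearZ /= trmxK.
by apply: Zs.2 => //; apply: UZ; exact: submxMl.
Qed.

(** The projector Q on the row space U satisfies (1 - Q) Q^t* = 0, as the rows of
    1 - Q are orthogonal to U; hence Q^t* = Q Q^t* is hermitian and equals Q. *)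
Lemma orth_projector n (Z : set 'cV[C]_n) : subspace Z ->
  exists P : 'M[C]_n,
    [/\ P^t* = P, forall x, Z (P *m x) & forall x, Z x -> P *m x = x].
Proof.
move=> /subspace_rowspan[U UZ]; pose Q := proj_ortho U.
have QU (x : 'rV_n) : (x *m Q <= U)%MS by exact: proj_ortho_sub.
have Qh : Q^t* = Q.
  have [D QD] := submxP (proj_ortho_sub U (1%:M)); rewrite mul1mx in QD.
  have := proj_ortho_compl_sub U 1%:M; rewrite mul1mx => /orthomx1P => h.
  have QQ : Q^t* = Q *m Q^t*.
    apply/eqP; rewrite -subr_eq0 -{1}[Q^t*]mul1mx -mulmxBl /Q {2}QD adjmxM.
    by rewrite mulmxA h mul0mx.
  have := congr1 (fun M => M^t*) QQ; rewrite (adjmxM Q) !trmxCK => QE.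
  by rewrite [RHS]QE -QQ.
exists Q^T; split.
- by apply/matrixP => i j; have /matrixP/(_ j i) := Qh; rewrite !mxE.
- by move=> x; apply/UZ; rewrite trmx_mul trmxK.
- by move=> x /UZ xU; rewrite -[LHS]trmxK trmx_mul trmxK proj_ortho_id ?trmxK.
Qed.

End OrthogonalProjection.

(** * Unitary corepresentations *)

Section Corepresentations.
Variables (C : numClosedFieldType) (A : algType C) (H : hopf_star_algebra A).
Local Notation S := (antipode H).
Local Notation D := (comul H).
Local Notation "a ^*" := (star H a) : ring_scope.
Implicit Types f g : {scalar A}.

Section OneCorep.
Variables (n : nat) (v : 'M[A]_n) (Uv : unitary_corep H v).

Lemma corep_comul i j : D (v i j) = \sum_k v i k ⊗ v k j.
Proof. by case: Uv. Qed.

Lemma corep_counit i j : counit H (v i j) = (i == j)%:R.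
Proof. by case: Uv. Qed.

Lemma corep_row i j : \sum_k v i k * (v j k)^* = (i == j)%:R.
Proof.
case: Uv => _ _ /matrixP/(_ i j) + _; rewrite !mxE => <-.
by apply: eq_bigr => k _; rewrite !mxE.
Qed.

Lemma corep_col i j : \sum_k (v k i)^* * v k j = (i == j)%:R.
Proof.
case: Uv => _ _ _ /matrixP/(_ i j); rewrite !mxE => <-.
by apply: eq_bigr => k _; rewrite !mxE.
Qed.

(** Right multiplication by v is undone by right multiplication by the adjoint
    of v, as v is unitary. *)
Lemma corep_solve (x y : 'I_n -> A) :
  (forall l, \sum_p x p * v p l = y l) -> forall q, x q = \sum_l y l * (v q l)^*.
Proof.
move=> xy q; under eq_bigr do rewrite -xy mulr_suml.
rewrite exchange_big /= (bigD1 q) //= [X in _ + X]big1 ?addr0.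
  under eq_bigr do rewrite -mulrA.
  by rewrite -mulr_sumr corep_row eqxx mulr1.
move=> p pq; under eq_bigr do rewrite -mulrA.
by rewrite -mulr_sumr corep_row (negbTE pq) mulr0.
Qed.

(** The antipode applied to the entries and the adjoint both invert v. *)
Lemma corep_antipode i j : S (v i j) = (v j i)^*.
Proof.
have SvE k : \sum_l S (v i l) * v l k = (i == k)%:R.
  have := antipodel H (v i k); rewrite corep_comul corep_counit tlift_sum.
    by move=> ->; rewrite scaler_nat.
  by split=> *; rewrite ?linearD ?mulrDl ?mulrDr // linearZ -scalerAl -scalerAr.
rewrite (corep_solve SvE) (bigD1 i) //= eqxx mul1r big1 ?addr0 // => k ki.
by rewrite eq_sym (negbTE ki) mul0r.
Qed.

(** Evaluating the entries of v at all functionals turns the corepresentation into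
    a representation of the convolution algebra by complex matrices.  It sends
    sharp to the adjoint, so linear algebra of hermitian matrices applies, and
    since functionals separate points no information on v is lost. *)
Definition fmx f : 'M[C]_n := map_mx f v.

Lemma fmx_conv f g : fmx (conv H f g) = fmx f *m fmx g.
Proof.
apply/matrixP => i j; rewrite !mxE /= corep_comul tlift_sum.
  by apply: eq_bigr => k _; rewrite !mxE.
exact: conv_balanced.
Qed.

Lemma fmx_sharp f : fmx (sharp H f) = (fmx f)^t*.
Proof.
by apply/matrixP => i j; rewrite !mxE /= corep_antipode starK.
Qed.

Lemma fmx_epsilon : fmx (epsilon H) = 1%:M.
Proof. by apply/matrixP => i j; rewrite !mxE /= corep_counit. Qed.

(** The matrices fmx f are closed under adjoints, so the orthogonal complement of
    an invariant subspace is invariant as well; that is, its projector commutes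
    with all of them. *)
Lemma invariant_projector (Z : set 'cV[C]_n) : subspace Z ->
  (forall f x, Z x -> Z (fmx f *m x)) ->
  exists P : 'M[C]_n,
    [/\ P^t* = P, forall x, Z (P *m x), forall x, Z x -> P *m x = x &
        forall f, P *m fmx f = fmx f *m P].
Proof.
move=> Zs Zinv; have [P [Ph PZ Pid]] := orth_projector Zs.
exists P; split=> // f.
have PfP g : P *m (fmx g *m P) = fmx g *m P.
  by apply: mulmx_colP => x; rewrite -mulmxA Pid // -mulmxA; apply: Zinv.
rewrite -PfP; have := PfP (sharp H f) => /(congr1 (fun M => M^t*)).
by rewrite !adjmxM fmx_sharp trmxCK Ph -mulmxA => ->.
Qed.

Definition coef (xi : 'rV[C]_n) (eta : 'cV[C]_n) : A :=
  \sum_i \sum_j (xi 0 i * eta j 0) *: v i j.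

Lemma coefE f xi eta : f (coef xi eta) = (xi *m fmx f *m eta) 0 0.
Proof.
rewrite linear_sum mxE.
under eq_bigr do rewrite linear_sum.
under [RHS]eq_bigr do rewrite mxE mulr_suml.
rewrite exchange_big; apply: eq_bigr => i _; apply: eq_bigr => j _.
by rewrite linearZ !mxE /= mulrAC.
Qed.

Lemma coef_eq0 xi eta :
  coef xi eta = 0 <-> forall f, xi *m fmx f *m eta = 0.
Proof.
split=> [c0 f|c0].
  by apply/matrixP => i j; rewrite !ord1 -coefE c0 linear0 mxE.
by apply: functional_inj => f; rewrite coefE c0 mxE linear0.
Qed.

(** P is the orthogonal projection on the vectors fixed by the corepresentation;
    the Haar functional takes the value P i j at v i j. *)
Definition haar_mx (P : 'M[C]_n) :=
  [/\ P^t* = P, forall f, fmx f *m P = f 1 *: P &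
      forall x : 'cV_n, (forall f, fmx f *m x = f 1 *: x) -> P *m x = x].

Lemma haar_mx_exists : exists P, haar_mx P.
Proof.
have Zs : subspace [set x : 'cV[C]_n | forall f, fmx f *m x = f 1 *: x].
  split=> [f|k x y /= xZ yZ f]; first by rewrite mulmx0 scaler0.
  by rewrite mulmxDr -scalemxAr xZ yZ scalerDr !scalerA mulrC.
have [P [Ph PZ Pid]] := orth_projector Zs; exists P; split=> // f.
by apply: mulmx_colP => x; rewrite -mulmxA PZ scalemxAl.
Qed.

Lemma haar_mxl P f : haar_mx P -> P *m fmx f = f 1 *: P.
Proof.
case=> Ph + _ => /(_ (sharp H f)) /(congr1 (fun M => M^t*)).
rewrite adjmxM fmx_sharp trmxCK Ph sharp1 => ->.
by rewrite linearZ /= map_mxZ /= conjCK Ph.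
Qed.

(** This makes the Haar functional well defined.  The vectors x with
    coef xi x = 0 form an invariant subspace K that contains eta.  Its projector Q
    preserves the space of fixed vectors, so it commutes with P and P eta lies
    in K; applying the counit to coef xi (P eta) = 0 gives the claim. *)
Lemma haar_mx_coef0 P xi eta : haar_mx P -> coef xi eta = 0 ->
  xi *m P *m eta = 0.
Proof.
move=> [Ph Pinv Pid] c0.
pose K := [set x : 'cV[C]_n | forall f, xi *m fmx f *m x = 0].
have Ks : subspace K.
  split=> [f|k x y /= xK yK f]; first by rewrite mulmx0.
  by rewrite mulmxDr -scalemxAr xK yK scaler0 addr0.
have [|Q [Qh QK Qid Qcomm]] := invariant_projector Ks.
  by move=> f x /= xK g; rewrite mulmxA -[_ *m _ *m fmx f]mulmxA -fmx_conv.
have PQP : P *m (Q *m P) = Q *m P.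
  apply: mulmx_colP => x; rewrite -mulmxA Pid // => f.
  by rewrite !mulmxA -Qcomm -(mulmxA Q) Pinv -scalemxAr -scalemxAl.
have PQ : P *m Q = Q *m P.
  rewrite -PQP; have /(congr1 (fun M => M^t*)) := PQP.
  by rewrite !adjmxM Ph Qh -mulmxA.
have Keta : K eta by move=> f; apply/coef_eq0: f.
have : K (P *m eta) by rewrite -(Qid _ Keta) mulmxA PQ -mulmxA; apply: QK.
by move=> /(_ (epsilon H)); rewrite fmx_epsilon mulmx1 mulmxA.
Qed.

End OneCorep.

End Corepresentations.

(** * Existence of the Haar functional *)

Section HaarFunctional.
Variables (C : numClosedFieldType) (A : algType C) (H : hopf_star_algebra A).
Local Notation S := (antipode H).
Local Notation D := (comul H).
Local Notation "a ^*" := (star H a) : ring_scope.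
Local Notation unitary := (unitary_corep H).
Implicit Types f g : {scalar A}.

Lemma tpure0l (a : A) : 0 ⊗ a = 0 :> tensor A A.
Proof. by rewrite -(scale0r 0) tpureZl scale0r. Qed.

Lemma tpure0r (a : A) : a ⊗ 0 = 0 :> tensor A A.
Proof.
by have [_ _ tZ] := @tpure_balanced C A A; rewrite -(scale0r 0) -tZ scale0r tpure0l.
Qed.

Lemma unitary_corep_trivial : unitary (1%:M : 'M[A]_1).
Proof.
split=> [i j|i j||].
- by rewrite big_ord1 !ord1 !mxE eqxx comul1.
- by rewrite !ord1 !mxE eqxx counit1.
- by apply/matrixP => i j; rewrite mul1mx !mxE !ord1 eqxx star1.
- by apply/matrixP => i j; rewrite mulmx1 !mxE !ord1 eqxx star1.
Qed.

Lemma unitary_corep_block n m (v : 'M[A]_n) (w : 'M[A]_m) :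
  unitary v -> unitary w -> unitary (block_mx v 0 0 w).
Proof.
move=> Uv Uw.
have star_mx0 p q : map_mx (star H) (0 : 'M[A]_(p, q)) = 0.
  by apply/matrixP => i j; rewrite !mxE star0.
split=> [i j|i j||].
- rewrite big_split_ord /=.
  case: (split_ordP i) => i' ->; case: (split_ordP j) => j' ->.
  + rewrite block_mxEul (corep_comul Uv) [X in _ + X]big1 ?addr0.
      by apply: eq_bigr => k _; rewrite !block_mxEul.
    by move=> k _; rewrite block_mxEur mxE tpure0l.
  + rewrite block_mxEur mxE linear0 !big1 ?addr0 // => k _.
      by rewrite block_mxEur mxE tpure0l.
    by rewrite block_mxEul block_mxEur mxE tpure0r.
  + rewrite block_mxEdl mxE linear0 !big1 ?addr0 // => k _.
      by rewrite block_mxEdr block_mxEdl mxE tpure0r.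
    by rewrite block_mxEdl mxE tpure0l.
  + rewrite block_mxEdr (corep_comul Uw) [X in X + _]big1 ?add0r.
      by apply: eq_bigr => k _; rewrite !block_mxEdr.
    by move=> k _; rewrite block_mxEdl mxE tpure0l.
- case: (split_ordP i) => i' ->; case: (split_ordP j) => j' ->.
  + by rewrite block_mxEul (corep_counit Uv) (inj_eq (@lshift_inj _ _)).
  + by rewrite block_mxEur mxE linear0 eq_lrshift.
  + by rewrite block_mxEdl mxE linear0 eq_rlshift.
  + by rewrite block_mxEdr (corep_counit Uw) (inj_eq (@rshift_inj _ _)).
- case: Uv Uw => _ _ v1 _ [_ _ w1 _].
  rewrite tr_block_mx map_block_mx !trmx0 !star_mx0 mulmx_block v1 w1.
  by rewrite !mulmx0 !mul0mx !addr0 !add0r scalar_mx_block.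
- case: Uv Uw => _ _ _ v1 [_ _ _ w1].
  rewrite tr_block_mx map_block_mx !trmx0 !star_mx0 mulmx_block v1 w1.
  by rewrite !mulmx0 !mul0mx !addr0 !add0r scalar_mx_block.
Qed.

Lemma fmx_block n m (v : 'M[A]_n) (w : 'M[A]_m) f :
  fmx (block_mx v 0 0 w) f = block_mx (fmx v f) 0 0 (fmx w f).
Proof. by rewrite /fmx map_block_mx !map_mx0. Qed.

Lemma coef_block n m (v : 'M[A]_n) (w : 'M[A]_m) xi xi' eta eta' :
  coef (block_mx v 0 0 w) (row_mx xi xi') (col_mx eta eta') =
  coef v xi eta + coef w xi' eta'.
Proof.
apply: functional_inj => f; rewrite raddfD /= !coefE fmx_block mul_row_block.
by rewrite !mulmx0 addr0 add0r mul_row_col mxE.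
Qed.

Lemma coefZ n (v : 'M[A]_n) k xi eta : coef v (k *: xi) eta = k *: coef v xi eta.
Proof.
by apply: functional_inj => f; rewrite linearZ /= !coefE -!scalemxAl mxE.
Qed.

Lemma coef_delta n (v : 'M[A]_n) i j : coef v (delta_mx 0 i) (delta_mx j 0) = v i j.
Proof.
by apply: functional_inj => f; rewrite coefE -rowE -colE !mxE.
Qed.

Lemma haar_mx_block n m (v : 'M[A]_n) (w : 'M[A]_m) P Q :
  haar_mx v P -> haar_mx w Q -> haar_mx (block_mx v 0 0 w) (block_mx P 0 0 Q).
Proof.
move=> [Ph Pinv Pid] [Qh Qinv Qid]; split.
- by rewrite tr_block_mx map_block_mx !trmx0 !map_mx0 Ph Qh.
- move=> f; rewrite fmx_block mulmx_block !mulmx0 !mul0mx !addr0 !add0r.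
  by rewrite Pinv Qinv scale_block_mx !scaler0.
- move=> x; rewrite -[x]vsubmxK => xinv; rewrite mul_block_col !mul0mx addr0 add0r.
  by rewrite Pid ?Qid // => f; have := xinv f; rewrite fmx_block mul_block_col
    !mul0mx addr0 add0r scale_col_mx => /eq_col_mx[].
Qed.

Variable HA : is_CQG H.

Lemma cqg_ind (P : A -> Prop) : P 0 ->
  (forall k a b, P a -> P b -> P (k *: a + b)) ->
  (forall n (v : 'M[A]_n) i j, unitary v -> P (v i j)) -> forall a, P a.
Proof.
move=> P0 PD Pv a; have : [set: A] a by [].
rewrite -HA => -[n [c [x [xE ->]]]].
elim/big_ind: _ => // [b b' Pb Pb'|i _].
  by rewrite -[b]scale1r; apply: PD.
by rewrite -[_ *: _]addr0; apply: PD => //; have [m [v [k [l [Uv ->]]]]] := xE i; apply: Pv.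
Qed.

(** Every element is a single matrix coefficient: sums of coefficients are
    coefficients of direct sums. *)
Lemma coefP a : exists n (v : 'M[A]_n) xi eta, unitary v /\ a = coef v xi eta.
Proof.
elim/cqg_ind: a => [|k a b [n [v [xi [eta [Uv ->]]]]] [m [w [xi' [eta' [Uw ->]]]]]
                   |n v i j Uv].
- exists 1%N, 1%:M, 0, 0; split; first exact: unitary_corep_trivial.
  by apply/esym/coef_eq0 => f; rewrite !mul0mx.
- exists (n + m)%N, (block_mx v 0 0 w), (row_mx (k *: xi) xi'), (col_mx eta eta').
  by split; [exact: unitary_corep_block|rewrite coef_block coefZ].
- by exists n, v, (delta_mx 0 i), (delta_mx j 0); rewrite coef_delta.
Qed.

Let haar_rel (a : A) (z : C) := exists n (v : 'M[A]_n) P xi eta,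
  [/\ unitary v, haar_mx v P, a = coef v xi eta & z = (xi *m P *m eta) 0 0].

(** The value at coef v xi eta is xi P eta.  Two presentations of the same element
    are compared by subtracting them inside the direct sum, which presents 0. *)
Lemma haar_exists : exists h : {scalar A},
  forall n (v : 'M[A]_n) P, unitary v -> haar_mx v P ->
    forall i j, h (v i j) = P i j.
Proof.
have relP k a b z y : haar_rel a z -> haar_rel b y ->
    haar_rel (k *: a + b) (k * z + y).
  move=> [n [v [P [xi [eta [Uv Pv -> ->]]]]]] [m [w [Q [xi' [eta' [Uw Qw -> ->]]]]]].
  exists (n + m)%N, (block_mx v 0 0 w), (block_mx P 0 0 Q), (row_mx (k *: xi) xi'),
    (col_mx eta eta').
  split; [exact: unitary_corep_block|exact: haar_mx_block|by rewrite coef_block coefZ|].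
  by rewrite mul_row_block !mulmx0 addr0 add0r mul_row_col -!scalemxAl !mxE.
have rel0 z : haar_rel 0 z -> z = 0.
  move=> [n [v [P [xi [eta [Uv Pv /esym c0 ->]]]]]].
  by rewrite (haar_mx_coef0 Uv Pv c0) mxE.
have reltot a : exists z, haar_rel a z.
  have [n [v [xi [eta [Uv ->]]]]] := coefP a; have [P Pv] := haar_mx_exists v.
  by exists ((xi *m P *m eta) 0 0); exists n, v, P, xi, eta.
have relfun a z y : haar_rel a z -> haar_rel a y -> z = y.
  move=> az ay; apply/eqP; rewrite -subr_eq0 -oppr_eq0 opprB addrC -mulN1r; apply/eqP.
  by apply: rel0; rewrite -(addNr a) -scaleN1r; apply: relP.
pose h a := projT1 (cid (reltot a)).
have hP a : haar_rel a (h a) by rewrite /h; case: cid.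
have hs : scalar h by move=> k a b; apply: relfun (hP _) _; apply: relP.
exists (functional_of hs) => n v P Uv Pv i j; apply: relfun (hP _) _.
exists n, v, P, (delta_mx 0 i), (delta_mx j 0); split=> //.
  by rewrite coef_delta.
by rewrite -rowE -colE !mxE.
Qed.

End HaarFunctional.

(** * Invariance of the Haar functional *)

Section HaarInvariance.
Variables (C : numClosedFieldType) (A : algType C) (H : hopf_star_algebra A).
Local Notation S := (antipode H).
Local Notation D := (comul H).
Local Notation "a ^*" := (star H a) : ring_scope.
Local Notation unitary := (unitary_corep H).
Implicit Types f g : {scalar A}.

Definition actl f (a : A) : A := tlift (fun x y => f x *: y) (D a).
Definition actr f (a : A) : A := tlift (fun x y => f y *: x) (D a).

Lemma actl_balanced f : balanced (fun x y : A => f x *: y).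
Proof.
by apply: bilinear_balanced; split=> a k x y /=;
  rewrite ?linearP ?scalerDl ?scalerDr ?scalerA // mulrC.
Qed.

Lemma actr_balanced f : balanced (fun x y : A => f y *: x).
Proof.
by apply: bilinear_balanced; split=> a k x y /=;
  rewrite ?linearP ?scalerDl ?scalerDr ?scalerA // mulrC.
Qed.

Lemma actlP f k a b : actl f (k *: a + b) = k *: actl f a + actl f b.
Proof.
rewrite /actl linearP tliftD; last exact: actl_balanced.
rewrite tliftZ //; first exact: actl_balanced.
by move=> c u v; rewrite linearZ scalerA.
Qed.

Lemma actrP f k a b : actr f (k *: a + b) = k *: actr f a + actr f b.
Proof.
rewrite /actr linearP tliftD; last exact: actr_balanced.
rewrite tliftZ //; first exact: actr_balanced.
by move=> c u v; rewrite scalerA mulrC -scalerA.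
Qed.

Lemma actl0 f : actl f 0 = 0.
Proof. by have := actlP f (-1) 0 0; rewrite scaler0 addr0 scaleN1r addNr. Qed.

Lemma actr0 f : actr f 0 = 0.
Proof. by have := actrP f (-1) 0 0; rewrite scaler0 addr0 scaleN1r addNr. Qed.

Lemma actl_sum f I (r : seq I) (x y : I -> A) a : D a = \sum_(i <- r) x i ⊗ y i ->
  actl f a = \sum_(i <- r) f (x i) *: y i.
Proof. by rewrite /actl => ->; apply: tlift_sum; exact: actl_balanced. Qed.

Lemma actr_sum f I (r : seq I) (x y : I -> A) a : D a = \sum_(i <- r) x i ⊗ y i ->
  actr f a = \sum_(i <- r) f (y i) *: x i.
Proof. by rewrite /actr => ->; apply: tlift_sum; exact: actr_balanced. Qed.

Lemma act_conv f g a : f (actr g a) = g (actl f a).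
Proof.
rewrite /actr /actl !linear_sum; apply: eq_bigr => p _.
by rewrite !linearZ /= mulrC.
Qed.

Definition is_haar (h : {scalar A}) :=
  [/\ h 1 = 1, forall a, actl h a = h a *: 1 & forall a, actr h a = h a *: 1].

(** For biinvariant normalised h and g, the convolution of h and g equals both h
    and g. *)
Lemma haar_uniq h g : is_haar h -> is_haar g -> h =1 g.
Proof.
move=> [h1 hl _] [g1 _ gr] a.
have := act_conv h g a; rewrite gr hl !linearZ /= h1 g1 !mulr1.
by move=> ->.
Qed.

Lemma star_functional_scalar f : scalar (fun a => conjC (f a^*)).
Proof.
by move=> k a b; rewrite starP linearP /= rmorphD rmorphM /= conjCK.
Qed.

Definition star_functional f := functional_of (star_functional_scalar f).

Lemma actl_star f a : actl f a^* = (actl (star_functional f) a)^*.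
Proof.
rewrite (actl_sum f (comul_star_sum (tensor_sum (D a)))).
rewrite (actl_sum _ (tensor_sum (D a))) star_sum; apply: eq_bigr => p _.
by rewrite starZ /= conjCK.
Qed.

Lemma actr_star f a : actr f a^* = (actr (star_functional f) a)^*.
Proof.
rewrite (actr_sum f (comul_star_sum (tensor_sum (D a)))).
rewrite (actr_sum _ (tensor_sum (D a))) star_sum; apply: eq_bigr => p _.
by rewrite starZ /= conjCK.
Qed.

(** The functional a |-> conj (h (star a)) is again normalised and biinvariant. *)
Lemma haar_star h : is_haar h -> forall a, h a^* = conjC (h a).
Proof.
move=> hh a; rewrite -{2}(starK H a).
suff /haar_uniq/(_ hh a^*) <- : is_haar (star_functional h) by rewrite /= starK.
have [h1 hl hr] := hh.
split=> [|b|b]; first by rewrite /= star1 h1 rmorph1.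
- apply: (can_inj (starK H)); rewrite -actl_star hl starZ star1 /= conjCK.
  by [].
- apply: (can_inj (starK H)); rewrite -actr_star hr starZ star1 /= conjCK.
  by [].
Qed.

(** This is the invariance of h at the products star (v i j) u k l, after the
    second factors have been multiplied on the left by the unitary matrix v.  Taken
    with v = u it says that Gram matrices intertwine u; paired with a functional it
    computes the adjoint of a convolution operator. *)
Lemma haar_shift h n (u : 'M[A]_n) m (v : 'M[A]_m) : is_haar h ->
  unitary u -> unitary v -> forall i s k l,
  \sum_q h ((v i s)^* * u k q) *: u q l = \sum_j h ((v i j)^* * u k l) *: v s j.
Proof.
move=> [_ hl _] Uu Uv i s k l.
have inv j : \sum_p \sum_q h ((v i p)^* * u k q) *: ((v p j)^* * u q l) =
    h ((v i j)^* * u k l) *: 1.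
  rewrite -hl /actl (comulM_sum (comul_star_sum (corep_comul Uv i j)) (corep_comul Uu k l)).
  by rewrite !pair_bigA /= tlift_sum //; exact: actl_balanced.
transitivity (\sum_j v s j * \sum_p \sum_q h ((v i p)^* * u k q) *: ((v p j)^* * u q l)).
  under [RHS]eq_bigr do rewrite mulr_sumr.
  rewrite exchange_big /= (bigD1 s) //= [X in _ = _ + X]big1 ?addr0.
    under [RHS]eq_bigr do rewrite mulr_sumr.
    rewrite exchange_big /=; apply: eq_bigr => q _.
    under eq_bigr do rewrite -scalerAr mulrA.
    by rewrite -scaler_sumr -mulr_suml (corep_row Uv) eqxx mul1r.
  move=> p ps; under eq_bigr do rewrite mulr_sumr.
  rewrite exchange_big /= big1 // => q _.
  under eq_bigr do rewrite -scalerAr mulrA.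
  by rewrite -scaler_sumr -mulr_suml (corep_row Uv) eq_sym (negbTE ps) mul0r scaler0.
by apply: eq_bigr => j _; rewrite inv -scalerAr mulr1.
Qed.

Hypothesis HA : is_CQG H.

Lemma haar_functional_exists : exists h, is_haar h.
Proof.
have [h hE] := haar_exists HA; exists h; split.
- have tr : haar_mx (1%:M : 'M[A]_1) 1%:M.
    split=> [|f|x xinv].
    - by rewrite trmx1 map_mx1.
    - by apply/matrixP => i j; rewrite mulmx1 !mxE !ord1 eqxx mulr1.
    - by rewrite mul1mx.
  by have := hE _ _ _ (unitary_corep_trivial H) tr 0 0; rewrite !mxE eqxx.
- elim/(cqg_ind HA) => [|k a b ha hb|n v i j Uv].
  + by rewrite actl0 linear0 scale0r.
  + by rewrite actlP ha hb linearP /= scalerDl scalerA.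
  have [P Pv] := haar_mx_exists v.
  rewrite (actl_sum h (corep_comul Uv i j)); apply: functional_inj => f.
  rewrite linear_sum linearZ /= (hE _ _ _ Uv Pv).
  have /matrixP/(_ i j) := haar_mxl Uv f Pv; rewrite !mxE mulrC => <-.
  by apply: eq_bigr => k _; rewrite linearZ /= (hE _ _ _ Uv Pv) mxE.
- elim/(cqg_ind HA) => [|k a b ha hb|n v i j Uv].
  + by rewrite actr0 linear0 scale0r.
  + by rewrite actrP ha hb linearP /= scalerDl scalerA.
  have [P Pv] := haar_mx_exists v.
  rewrite (actr_sum h (corep_comul Uv i j)); apply: functional_inj => f.
  rewrite linear_sum linearZ /= (hE _ _ _ Uv Pv).
  have [_ + _] := Pv; move=> /(_ f)/matrixP/(_ i j); rewrite !mxE mulrC => <-.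
  by apply: eq_bigr => k _; rewrite linearZ /= (hE _ _ _ Uv Pv) mxE mulrC.
Qed.

End HaarInvariance.

(** * Positivity of the Haar functional *)

Section HaarPositivity.
Variables (C : numClosedFieldType) (A : algType C) (H : hopf_star_algebra A).
Local Notation D := (comul H).
Local Notation "a ^*" := (star H a) : ring_scope.
Local Notation unitary := (unitary_corep H).
Implicit Types f g : {scalar A}.

Lemma coefPr n (v : 'M[A]_n) xi k x y :
  coef v xi (k *: x + y) = k *: coef v xi x + coef v xi y.
Proof.
apply: functional_inj => f; rewrite linearP /= !coefE.
by rewrite mulmxDr -scalemxAr !mxE.
Qed.

Lemma coef0r n (v : 'M[A]_n) xi : coef v xi 0 = 0.
Proof. by apply/coef_eq0 => f; rewrite mulmx0. Qed.

Lemma coef_sumr n (v : 'M[A]_n) xi I (r : seq I) (F : I -> 'cV_n) :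
  coef v xi (\sum_(i <- r) F i) = \sum_(i <- r) coef v xi (F i).
Proof.
apply: (big_morph (coef v xi) _ (coef0r v xi)) => x y.
by have := coefPr v xi 1 x y; rewrite !scale1r.
Qed.

Lemma coef_col n (v : 'M[A]_n) xi x :
  coef v xi x = \sum_j x j 0 *: coef v xi (delta_mx j 0).
Proof.
have {1}-> : x = \sum_j x j 0 *: delta_mx j 0.
  by rewrite [LHS]matrix_sum_delta; apply: eq_bigr => i _; rewrite big_ord1.
rewrite coef_sumr; apply: eq_bigr => j _.
by rewrite -[_ *: _]addr0 coefPr coef0r addr0.
Qed.

Lemma coef_deltar n (v : 'M[A]_n) xi j :
  coef v xi (delta_mx j 0) = \sum_i xi 0 i *: v i j.
Proof.
apply: functional_inj => f; rewrite coefE -mulmxA -colE linear_sum mxE.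
by apply: eq_bigr => i _; rewrite linearZ !mxE.
Qed.

Lemma actr_coef n (v : 'M[A]_n) (Uv : unitary v) f xi x :
  actr H f (coef v xi x) = coef v xi (fmx v f *m x).
Proof.
apply: functional_inj => g; rewrite act_conv.
have -> : f (actl H g (coef v xi x)) = conv H g f (coef v xi x).
  by rewrite /= /actl linear_sum; apply: eq_bigr => p _; rewrite linearZ.
by rewrite !coefE fmx_conv // !mulmxA.
Qed.

(** Presentations of the separate elements are combined in the direct sum of their
    corepresentations, with the left vectors side by side. *)
Lemma coef_family (HA : is_CQG H) N (a : 'I_N -> A) :
  exists m (v : 'M[A]_m) xi (E : 'M[C]_(m, N)),
    unitary v /\ forall j, a j = coef v xi (col j E).
Proof.
elim: N a => [|N IHN] a.
  exists 1%N, 1%:M, 0, 0; split; first exact: unitary_corep_trivial.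
  by case.
have [n [w [eta [x [Uw a0]]]]] := coefP HA (a ord0).
have [m [v [xi [E [Uv aE]]]]] := IHN (fun j => a (lift ord0 j)).
exists (n + m)%N, (block_mx w 0 0 v), (row_mx eta xi).
exists (block_mx x 0 0 E : 'M[C]_(n + m, 1 + N)).
split; first exact: unitary_corep_block.
have colr k : col (rshift 1 k) (block_mx x 0 0 E) = col_mx 0 (col k E).
  by rewrite block_mxEh colKr col_col_mx col0.
have coll k : col (lshift N k) (block_mx x 0 0 E) = col_mx x 0.
  by rewrite block_mxEh colKl col_col_mx col0 col_id.
move=> j; case: (unliftP ord0 j) => [k ->|->].
  have -> : lift ord0 k = rshift 1 k by exact: val_inj.
  rewrite colr coef_block coef0r add0r -aE.
  by congr a; exact: val_inj.
have -> : ord0 = lshift N ord0 :> 'I_(1 + N) by apply: val_inj.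
rewrite coll coef_block coef0r addr0 -a0.
by congr a; exact: val_inj.
Qed.

Variables (HA : is_CQG H) (h : {scalar A}) (hh : is_haar H h).

Section Gram.
Variables (n : nat) (u : 'M[A]_n) (Uu : unitary u) (xi : 'rV[C]_n).

Local Notation w x := (coef u xi x).

(** The Gram matrix, for the form h (star a * b), of the row xi u. *)
Definition gram : 'M[C]_n :=
  \matrix_(i, j) h ((w (delta_mx i 0))^* * w (delta_mx j 0)).

Lemma gramE x y : h ((w x)^* * w y) = (x^t* *m gram *m y) 0 0.
Proof.
rewrite (coef_col _ _ x) (coef_col _ _ y) star_sum mulr_suml linear_sum.
rewrite mxE; under [RHS]eq_bigr do rewrite mxE mulr_suml.
rewrite exchange_big; apply: eq_bigr => i _; rewrite mulr_sumr linear_sum.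
apply: eq_bigr => j _.
by rewrite starZ -scalerAl -scalerAr !linearZ /= !mxE mulrA mulrAC.
Qed.

Lemma gram_herm : gram^t* = gram.
Proof.
by apply/matrixP => i j; rewrite !mxE -(haar_star hh) starM starK.
Qed.

Lemma gram_entry s q :
  gram s q = \sum_i \sum_k (conjC (xi 0 i) * xi 0 k) * h ((u i s)^* * u k q).
Proof.
rewrite mxE !coef_deltar star_sum mulr_suml linear_sum; apply: eq_bigr => i _.
rewrite mulr_sumr linear_sum; apply: eq_bigr => k _.
by rewrite starZ -scalerAl -scalerAr scalerA linearZ.
Qed.

(** This is haar_shift for v = u, contracted with xi on both sides. *)
Lemma gram_comm f : gram *m fmx u f = fmx u f *m gram.
Proof.
have fsum (I : finType) (c : I -> I -> C) (e : I -> I -> I -> C) (b : I -> A) :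
    f (\sum_i \sum_k c i k *: \sum_q e i k q *: b q) =
    \sum_q (\sum_i \sum_k c i k * e i k q) * f (b q).
  under [RHS]eq_bigr do rewrite mulr_suml.
  rewrite [RHS]exchange_big linear_sum; apply: eq_bigr => i _.
  under [RHS]eq_bigr do rewrite mulr_suml.
  rewrite [RHS]exchange_big linear_sum; apply: eq_bigr => k _.
  rewrite linearZ /= linear_sum mulr_sumr; apply: eq_bigr => q _.
  by rewrite linearZ /= mulrA.
apply/matrixP => s l; rewrite !mxE.
transitivity (f (\sum_i \sum_k (conjC (xi 0 i) * xi 0 k) *:
     \sum_q h ((u i s)^* * u k q) *: u q l)).
  by rewrite fsum; apply: eq_bigr => q _; rewrite gram_entry mxE.
transitivity (f (\sum_i \sum_k (conjC (xi 0 i) * xi 0 k) *: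
     \sum_q h ((u i q)^* * u k l) *: u s q)).
  congr (f _); apply: eq_bigr => i _; apply: eq_bigr => k _.
  by rewrite (haar_shift hh Uu Uu).
by rewrite fsum; apply: eq_bigr => q _; rewrite gram_entry mxE mulrC.
Qed.

Lemma sqnorm_ge0 m (x : 'cV[C]_m) : 0 <= (x^t* *m x) 0 0.
Proof.
by rewrite mxE sumr_ge0 // => i _; rewrite !mxE mulrC mul_conjC_ge0.
Qed.

(** The elements coef u xi x with x in the eigenspace of lam form a right
    subcomodule W of A, on which h (star b * b) is lam times the square of the
    length of x.  The adjoints of the elements of W form a right subcomodule again,
    and this one is presented by a unitary corepresentation v, a row eta and the
    invariant subspace Z.  With P the projector on Z, the entries of the row
    (eta P) v lie in star W.  As v is unitary, the sum of entry times adjoint entry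
    is the constant |eta P|^2, which is positive since star W is not 0.  Each of
    these products has the form star b * b with b in W, so the value of h at the
    sum is lam times a nonnegative number. *)
Lemma gram_eigen_gt0 lam x0 : gram *m x0 = lam *: x0 -> w x0 != 0 -> 0 < lam.
Proof.
move=> gx0 wx0.
have [m [v [eta [E [Uv vE]]]]] := coef_family HA (fun j => (w (delta_mx j 0))^*).
have starw x : (w x)^* = coef v eta (E *m map_mx conjC x).
  rewrite coef_col star_sum.
  have -> : E *m map_mx conjC x = \sum_j conjC (x j 0) *: col j E.
    apply/colP => i; rewrite summxE !mxE; apply: eq_bigr => j _.
    by rewrite !mxE mulrC.
  rewrite coef_sumr; apply: eq_bigr => j _.
  by rewrite starZ vE -[in RHS](addr0 (_ *: _)) coefPr coef0r addr0.
pose Z := [set y : 'cV[C]_m |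
  exists2 x, gram *m x = lam *: x & coef v eta y = (w x)^*].
have Zs : subspace Z.
  split; first by exists 0; rewrite ?mulmx0 ?scaler0 // !coef0r star0.
  move=> k y y' [x gx yx] [x' gx' yx']; exists (conjC k *: x + x').
    by rewrite mulmxDr -scalemxAr gx gx' scalerDr !scalerA mulrC.
  by rewrite !coefPr starP conjCK yx yx'.
have [|P [Ph PZ Pid Pcomm]] := invariant_projector Uv Zs.
  move=> f y [x gx yx]; exists (fmx u (star_functional H f) *m x).
    by rewrite mulmxA gram_comm -mulmxA gx scalemxAr.
  by rewrite -(actr_coef Uv) yx actr_star (actr_coef Uu).
pose r := eta *m P.
have rE y : coef v r y = coef v eta (P *m y).
  by apply: functional_inj => f; rewrite !coefE /r !mulmxA -[eta *m P *m _]mulmxA Pcomm mulmxA.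
(* If r = 0, then coef v eta vanishes on Z, which contains a vector presenting
   star (w x0). *)
have r0 : r != 0.
  apply: contraNneq wx0 => r0; rewrite -(starK H (w x0)) starw.
  suff -> : coef v eta (E *m map_mx conjC x0) = 0 by rewrite star0.
  rewrite -[E *m _]Pid; first by rewrite -rE r0; apply/coef_eq0 => f; rewrite !mul0mx.
  by exists x0; rewrite // starw.
have /choice[z zP] : forall a, exists x, gram *m x = lam *: x /\
    coef v r (delta_mx a 0) = (w x)^*.
  by move=> a; rewrite rE; have [x] := PZ (delta_mx a 0); exists x.
(* The entries coef v r e_a of the row r v are the adjoints of the w (z a),
   so that unitarity of v evaluates the sum. *)
have sumE : \sum_a (w (z a))^* * w (z a) = (r *m r^t*) 0 0 *: 1.
  transitivity (\sum_a coef v r (delta_mx a 0) * (coef v r (delta_mx a 0))^*).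
    by apply: eq_bigr => a _; rewrite (zP a).2 starK.
  under eq_bigr => a _ do rewrite coef_deltar star_sum mulr_suml.
  rewrite exchange_big mxE scaler_suml; apply: eq_bigr => b _ /=.
  under eq_bigr do rewrite mulr_sumr.
  rewrite exchange_big /= (bigD1 b) //= [X in _ + X]big1 ?addr0.
    under eq_bigr do rewrite starZ -scalerAl -scalerAr scalerA.
    by rewrite -scaler_sumr (corep_row Uv) eqxx !mxE.
  move=> c cb; under eq_bigr do rewrite starZ -scalerAl -scalerAr scalerA.
  by rewrite -scaler_sumr (corep_row Uv) eq_sym (negbTE cb) scaler0.
have [h1 _ _] := hh.
have := congr1 h sumE; rewrite linearZ /= h1 mulr1 linear_sum.
under eq_bigr => a _ do rewrite gramE -mulmxA (zP a).1 -scalemxAr mxE.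
rewrite -mulr_sumr => lamE.
have t0 : 0 < (r *m r^t*) 0 0 by rewrite -dotmxE dnorm_gt0.
have : 0 <= \sum_i ((z i)^t* *m z i) 0 0.
  by apply: sumr_ge0 => i _; exact: sqnorm_ge0.
rewrite le_eqVlt => /predU1P[s0|s0]; first by rewrite -lamE -s0 mulr0 ltxx in t0.
by rewrite -lamE pmulr_lgt0 in t0.
Qed.

End Gram.

(** Write a = coef u xi eta and decompose eta into eigenvectors x j of the Gram
    matrix.  By gram_eigen_gt0 the eigenvectors of eigenvalue <= 0 do not contribute
    to a, and the remaining ones contribute nonnegative terms to h (star a * a), not
    all zero. *)
Lemma haar_positive a : a != 0 -> 0 < h (a^* * a).
Proof.
have [n [u [xi [eta [Uu ->]]]]] := coefP HA a => a0.
pose g := gram u xi; pose P := spectralmx g; pose d := spectral_diag g.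
have PU : P \is unitarymx by exact: spectral_unitarymx.
have gE : g = P^t* *m diag_mx d *m P.
  rewrite -invmx_unitary //; apply/orthomx_spectralP/normalmxP.
  by rewrite gram_herm.
have PP : P *m P^t* = 1%:M by apply/unitarymxP.
have PP' : P^t* *m P = 1%:M by apply: mulmx1C.
pose y := P *m eta; pose x j := y j 0 *: col j (P^t*).
have etaE : eta = \sum_j x j.
  rewrite -[LHS]mul1mx -PP' -mulmxA; apply/colP => i; rewrite summxE !mxE.
  by apply: eq_bigr => j _; rewrite !mxE mulrC.
have gx j : g *m x j = d 0 j *: x j.
  rewrite -scalemxAr colE gE -!mulmxA (mulmxA P) PP mul1mx -colE.
  have -> : col j (diag_mx d) = d 0 j *: delta_mx j 0.
    by apply/colP => i; rewrite !mxE eqxx andbT; case: eqVneq => [->|];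
      rewrite ?mulr1n ?mulr1 ?mulr0n ?mulr0.
  by rewrite -scalemxAr -colE scalerA mulrC -scalerA.
have hE : h ((coef u xi eta)^* * coef u xi eta) = \sum_j d 0 j * `|y j 0| ^+ 2.
  rewrite gramE -/g gE !mulmxA -mulmxA -/y -adjmxM -/y.
  rewrite -mulmxA mul_diag_mx mxE; apply: eq_bigr => j _.
  by rewrite !mxE normCK mulrCA; congr (_ * _); rewrite mulrC.
have pos j : coef u xi (x j) != 0 -> 0 < d 0 j.
  by apply: gram_eigen_gt0.
have term j : d 0 j * `|y j 0| ^+ 2 = h ((coef u xi (x j))^* * coef u xi (x j)).
  rewrite gramE -mulmxA gx -scalemxAr [RHS]mxE; congr (_ * _).
  rewrite [RHS]mxE normCK.
  have /matrixP/(_ j j) := PP; rewrite !mxE eqxx mulr1n => PPj.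
  rewrite -[LHS]mulr1 -PPj mulr_sumr; apply: eq_bigr => i _.
  by rewrite !mxE rmorphM /= conjCK [X in X * _ = _]mulrC mulrACA.
have ge0 i : 0 <= d 0 i * `|y i 0| ^+ 2.
  have [c0|ciN0] := eqVneq (coef u xi (x i)) 0.
    by rewrite term c0 mulr0 linear0.
  by rewrite mulr_ge0 ?exprn_ge0 // ltW // pos.
rewrite hE lt_neqAle sumr_ge0 ?andbT //.
apply: contraNneq a0 => s0; rewrite etaE coef_sumr big1 // => j _.
apply/eqP/negPn/negP => cN0.
move: s0 => /esym/eqP; rewrite psumr_eq0 // => /allP/(_ j (mem_index_enum _)) /=.
rewrite mulf_eq0 gt_eqF ?pos //= expf_eq0 /= normr_eq0 => /eqP yj.
by rewrite /x yj scale0r coef0r eqxx in cN0.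
Qed.

End HaarPositivity.

(** * Contractions of a left-covariant calculus *)

Section CovariantCalculus.
Variables (C : numClosedFieldType) (A : algType C) (H : hopf_star_algebra A).
Hypothesis HA : is_CQG H.
Local Notation S := (antipode H).
Local Notation D := (comul H).
Local Notation "a ^*" := (star H a) : ring_scope.
Local Notation unitary := (unitary_corep H).
Variables (G : lmodType C) (Gam : fodc A G).
Local Notation d := (fodc_d Gam).
Local Notation "a ◃ g" := (lact Gam a g) (at level 40, g at level 39).
Local Notation "g ▹ a" := (ract Gam g a) (at level 40, a at level 39).

Lemma lact_bilinear : bilinear_for *:%R *:%R (fun a g => a ◃ g).
Proof.
by split=> [g|a] k x y /=; rewrite ?linearPl ?linearPr.
Qed.

Lemma lactPl k a b g : (k *: a + b) ◃ g = k *: (a ◃ g) + b ◃ g.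
Proof. exact: lact_bilinear.1. Qed.

Lemma lactPr k a g g' : a ◃ (k *: g + g') = k *: (a ◃ g) + a ◃ g'.
Proof. exact: lact_bilinear.2. Qed.

Lemma fodc_ind (P : G -> Prop) : P 0 ->
  (forall k g g', P g -> P g' -> P (k *: g + g')) ->
  (forall a b, P (a ◃ d b)) -> forall g, P g.
Proof.
move=> P0 PD Pd g; have : [set: G] g by [].
rewrite -(fodc_span Gam) => -[n [c [x [xE ->]]]].
elim/big_ind: _ => // [y z Py Pz|i _].
  by rewrite -[y]scale1r; apply: PD.
by rewrite -[_ *: _]addr0; apply: PD => //; have [a [b ->]] := xE i; apply: Pd.
Qed.

Lemma fodc_d1 : d 1 = 0.
Proof.
apply: (addrI (d 1)); rewrite addr0 -{3}(mulr1 1) fodc_leibniz lact1.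
by rewrite ract1.
Qed.

(** The antipode reverses products.  Solving the antipode axiom for v i r * u k q
    by corep_solve, first for u and then for v, leaves the product of the two
    adjoint entries. *)
Lemma antipodeM n (u : 'M[A]_n) m (v : 'M[A]_m) : unitary u -> unitary v ->
  forall i r k q, S (v i r * u k q) = (u q k)^* * (v r i)^*.
Proof.
move=> Uu Uv i r k q.
have inv j l : \sum_m' \sum_p S (v i m' * u k p) * (v m' j * u p l) =
    ((i == j)%:R * (k == l)%:R : C) *: 1.
  have := antipodel H (v i j * u k l).
  rewrite (comulM_sum (corep_comul Uv i j) (corep_comul Uu k l)) pair_bigA.
  rewrite counitM (corep_counit Uv) (corep_counit Uu) => <-.
  rewrite tlift_sum ?pair_bigA //.
  by split=> *; rewrite ?linearD ?mulrDl ?mulrDr // linearZ -scalerAl -scalerAr.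
have invu j := corep_solve Uu (x := fun p => \sum_m' S (v i m' * u k p) * v m' j).
have {inv}invu j p : \sum_m' S (v i m' * u k p) * v m' j =
    (i == j)%:R *: (u p k)^*.
  rewrite (invu j (fun l => ((i == j)%:R * (k == l)%:R : C) *: 1)).
    rewrite (bigD1 k) //= eqxx mulr1 -scalerAl mul1r big1 ?addr0 // => l lk.
    by rewrite [k == l]eq_sym (negbTE lk) mulr0 scale0r mul0r.
  move=> l; rewrite -inv exchange_big; apply: eq_bigr => p' _.
  by rewrite mulr_suml; apply: eq_bigr => m' _; rewrite mulrA.
rewrite (corep_solve Uv (fun j => invu j q)).
rewrite (bigD1 i) //= eqxx scale1r big1 ?addr0 // => j ji.
by rewrite eq_sym (negbTE ji) scale0r mul0r.
Qed.

Lemma lact0l g : 0 ◃ g = 0.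
Proof. exact: linear0l. Qed.

Lemma lact0r a : a ◃ 0 = 0.
Proof. exact: linear0r. Qed.

Lemma lact_suml I (r : seq I) (x : I -> A) g :
  (\sum_(i <- r) x i) ◃ g = \sum_(i <- r) x i ◃ g.
Proof.
apply: (big_morph (fun a => a ◃ g)) => [x' y|]; last exact: lact0l.
by rewrite -{1}[x']scale1r lactPl scale1r.
Qed.

Lemma lact_sumr I (r : seq I) a (x : I -> G) :
  a ◃ (\sum_(i <- r) x i) = \sum_(i <- r) a ◃ x i.
Proof.
apply: (big_morph (fun g => a ◃ g)) => [x' y|]; last exact: lact0r.
by rewrite -{1}[x']scale1r lactPr scale1r.
Qed.

Lemma lactZl k a g : (k *: a) ◃ g = k *: (a ◃ g).
Proof. by rewrite -[k *: a]addr0 lactPl lact0l addr0. Qed.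

Lemma lactZr k a g : a ◃ (k *: g) = k *: (a ◃ g).
Proof. by rewrite -[k *: g]addr0 lactPr lact0r addr0. Qed.

Lemma lact_natl (b : bool) g : (b%:R : A) ◃ g = (b%:R : C) *: g.
Proof. by case: b; rewrite ?lact1 ?scale1r // lact0l scale0r. Qed.

(** The left-invariant form S(a1) d(a2). *)
Definition maurer_cartan (a : A) : G := tlift (fun x y => S x ◃ d y) (D a).
Local Notation omega := maurer_cartan.

Lemma maurer_cartan_balanced : balanced (fun x y => S x ◃ d y).
Proof.
by apply: bilinear_balanced; split=> a k x y /=; rewrite linearP ?lactPl ?lactPr.
Qed.

Lemma maurer_cartanP k a b : omega (k *: a + b) = k *: omega a + omega b.
Proof.
rewrite /maurer_cartan linearP tliftD; last exact: maurer_cartan_balanced.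
rewrite tliftZ //; first exact: maurer_cartan_balanced.
by move=> c x y; rewrite linearZ lactZl.
Qed.

Lemma maurer_cartan0 : omega 0 = 0.
Proof. by have := maurer_cartanP (-1) 0 0; rewrite scaler0 addr0 scaleN1r addNr. Qed.

Lemma maurer_cartanE n (u : 'M[A]_n) k l : unitary u ->
  omega (u k l) = \sum_m (u m k)^* ◃ d (u m l).
Proof.
move=> Uu; rewrite /maurer_cartan (corep_comul Uu) tlift_sum.
  by apply: eq_bigr => m _; rewrite (corep_antipode Uu).
exact: maurer_cartan_balanced.
Qed.

(** Hence the calculus is generated, as a left module, by the forms omega a. *)
Lemma d_maurer_cartan n (u : 'M[A]_n) q l : unitary u ->
  d (u q l) = \sum_k u q k ◃ omega (u k l).
Proof.
move=> Uu; under eq_bigr do rewrite maurer_cartanE // lact_sumr.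
rewrite exchange_big /=; under eq_bigr do under eq_bigr do rewrite -lactM.
under eq_bigr do rewrite -lact_suml (corep_row Uu) lact_natl.
rewrite (bigD1 q) //= eqxx scale1r big1 ?addr0 // => m mq.
by rewrite eq_sym (negbTE mq) scale0r.
Qed.

Section LeftCoaction.
Variables (DL : {linear G -> tensor A G}) (DLE : is_left_coaction H Gam DL).

Lemma coaction_sum I J (r : seq I) (s : seq J) (a b : I -> A) (a' b' : J -> A) c c' :
  D c = \sum_(i <- r) a i ⊗ b i -> D c' = \sum_(j <- s) a' j ⊗ b' j ->
  DL (c ◃ d c') = \sum_(i <- r) \sum_(j <- s) (a i * a' j) ⊗ (b i ◃ d (b' j)).
Proof.
move=> Dc Dc'; rewrite DLE Dc Dc'.
rewrite tmap_sum; last exact: (tmap_lin_balanced idfun d).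
by rewrite tmul2_sum //; [exact: mul_bilinear|exact: lact_bilinear].
Qed.

Lemma maurer_cartan_invariant a : left_invariant DL (omega a).
Proof.
rewrite /left_invariant /=; elim/(cqg_ind HA): a => [|k a b ha hb|n u k l Uu].
- rewrite maurer_cartan0 linear0; have [_ tr] := @tpure_bilinear C A G.
  by have /= := tr 1 (-1) 0 0; rewrite scaler0 addr0 scaleN1r addNr.
- rewrite maurer_cartanP linearP ha hb.
  by have [_ tr] := @tpure_bilinear C A G; rewrite tr.
have [tl tr] := @tpure_bilinear C A G.
have t0 (g : G) : (0 : A) ⊗ g = 0 by rewrite -(scale0r 0) tpureZl scale0r.
have tsumr (x : 'I_n -> G) : 1 ⊗ (\sum_m x m) = \sum_m (1 : A) ⊗ x m.
  have [_ tDr tZ] := @tpure_balanced C A G.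
  apply: (big_morph (fun g => 1 ⊗ g) (tDr 1)).
  by rewrite -(scale0r 0) -tZ tpureZl scale0r.
have tsuml (x : 'I_n -> A) (g : G) : (\sum_m x m) ⊗ g = \sum_m x m ⊗ g.
  have [tDl _ _] := @tpure_balanced C A G.
  exact: (big_morph (fun a => a ⊗ g) (fun x y => tDl x y g) (t0 g)).
rewrite maurer_cartanE // linear_sum tsumr.
under eq_bigr => m _ do rewrite (coaction_sum (comul_star_sum (corep_comul Uu m k))
  (corep_comul Uu m l)).
rewrite exchange_big /=; apply: eq_bigr => p _.
rewrite exchange_big /= (bigD1 p) //= [X in _ + X]big1 ?addr0 => [|q qp].
  by rewrite -tsuml (corep_col Uu) eqxx.
by rewrite -tsuml (corep_col Uu) eq_sym (negbTE qp) t0.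
Qed.

(** The map g |-> S(g(-1)) g(0), which projects on the left-invariant forms and
    sends a db to counit a times omega b. *)
Definition inv_part (g : G) : G := tlift (fun x y => S x ◃ y) (DL g).

Lemma inv_part_balanced : balanced (fun (x : A) (y : G) => S x ◃ y).
Proof.
by apply: bilinear_balanced; split=> a k x y /=; rewrite ?linearP ?lactPl ?lactPr.
Qed.

Lemma inv_partP k g g' : inv_part (k *: g + g') = k *: inv_part g + inv_part g'.
Proof.
rewrite /inv_part linearP tliftD; last exact: inv_part_balanced.
rewrite tliftZ //; first exact: inv_part_balanced.
by move=> c x y; rewrite linearZ lactZl.
Qed.

Lemma inv_part_entry n (u : 'M[A]_n) m (v : 'M[A]_m) i j k l :
  unitary u -> unitary v ->
  inv_part (v i j ◃ d (u k l)) = ((i == j)%:R : C) *: omega (u k l).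
Proof.
move=> Uu Uv; rewrite /inv_part (coaction_sum (corep_comul Uv i j) (corep_comul Uu k l)).
rewrite pair_bigA tlift_sum; last exact: inv_part_balanced.
rewrite -(pair_bigA _ (fun p q => S (v i p * u k q) ◃ (v p j ◃ d (u q l)))) /=.
under eq_bigr do under eq_bigr do rewrite (antipodeM Uu Uv) -lactM -mulrA lactM.
rewrite exchange_big maurer_cartanE // scaler_sumr; apply: eq_bigr => q _ /=.
by rewrite -lact_sumr -lact_suml (corep_col Uv) lact_natl lactZr.
Qed.

(** The map g |-> phi(inv_part g(0)) g(-1).  If the calculus is seen as A tensored
    with the left-invariant forms, this is the identity tensored with phi. *)
Definition contract (phi : {scalar G}) (g : G) : A :=
  tlift (fun x y => phi (inv_part y) *: x) (DL g).

Lemma contract_balanced (phi : {scalar G}) : balanced (fun (x : A) y => phi (inv_part y) *: x).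
Proof.
apply: bilinear_balanced; split=> a k x y /=.
  by rewrite scalerDr !scalerA mulrC.
by rewrite inv_partP (linearP phi) scalerDl scalerA.
Qed.

Lemma contractP phi k g g' :
  contract phi (k *: g + g') = k *: contract phi g + contract phi g'.
Proof.
rewrite /contract linearP tliftD; last exact: contract_balanced.
rewrite tliftZ //; first exact: contract_balanced.
by move=> c x y; rewrite scalerA mulrC -scalerA.
Qed.

Lemma contract0 phi : contract phi 0 = 0.
Proof. by have := contractP phi (-1) 0 0; rewrite scaler0 addr0 scaleN1r addNr. Qed.

(** As inv_part sends c db to counit c times omega b, the left factor a comes out
    unchanged; what remains on differentials is right convolution by phi o omega. *)
Lemma contract_entry phi n (u : 'M[A]_n) k l a : unitary u ->
  contract phi (a ◃ d (u k l)) = a * \sum_p phi (omega (u p l)) *: u k p.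
Proof.
move=> Uu; elim/(cqg_ind HA): a => [|c a b ha hb|m v i j Uv].
- by rewrite lact0l contract0 mul0r.
- by rewrite lactPl contractP ha hb mulrDl -scalerAl.
rewrite /contract (coaction_sum (corep_comul Uv i j) (corep_comul Uu k l)).
rewrite pair_bigA tlift_sum; last exact: contract_balanced.
rewrite -(pair_bigA _ (fun p q => phi (inv_part (v p j ◃ d (u q l))) *: (v i p * u k q))) /=.
rewrite (bigD1 j) //= [X in _ + X]big1 ?addr0.
  rewrite mulr_sumr; apply: eq_bigr => q _.
  by rewrite inv_part_entry // eqxx scale1r scalerAr.
move=> p pj; rewrite big1 // => q _.
by rewrite inv_part_entry // (negbTE pj) scale0r linear0 scale0r.
Qed.

Lemma contractM phi a g : contract phi (a ◃ g) = a * contract phi g.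
Proof.
elim/fodc_ind: g => [|k g g' hg hg'|b c].
- by rewrite lact0r contract0 mulr0.
- by rewrite lactPr !contractP hg hg' mulrDr scalerAr.
rewrite -lactM; elim/(cqg_ind HA): c => [|k x y hx hy|n u i j Uu].
- by rewrite linear0 !lact0r contract0 mulr0.
- by rewrite linearP !lactPr !contractP hx hy mulrDr scalerAr.
by rewrite !contract_entry // mulrA.
Qed.

Variables (h : {scalar A}) (hh : is_haar H h).
Variables (st : G -> G) (stA : antilinear st).
Hypothesis stE : forall a b c, st ((a ◃ d b) ▹ c) = (c^* ◃ d b^*) ▹ a^*.

Lemma st0 : st 0 = 0.
Proof. by have := stA (-1) 0 0; rewrite scaler0 addr0 rmorphN1 scaleN1r addNr. Qed.

Lemma st_sum n (x : 'I_n -> G) : st (\sum_m x m) = \sum_m st (x m).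
Proof.
apply: (big_morph st) => [y z|]; last exact: st0.
by have := stA 1 y z; rewrite rmorph1 !scale1r.
Qed.

(** The sum over m of star (u m l) * u m k is a scalar, so its differential
    vanishes; the Leibniz rule splits this differential into omega (u l k) and
    st (omega (u k l)). *)
Lemma st_maurer_cartan n (u : 'M[A]_n) k l : unitary u ->
  st (omega (u k l)) = - omega (u l k).
Proof.
move=> Uu; rewrite !maurer_cartanE // st_sum.
apply/eqP; rewrite -addr_eq0 -big_split /=; apply/eqP.
transitivity (d (\sum_m (u m l)^* * u m k)).
  rewrite linear_sum; apply: eq_bigr => m _.
  rewrite fodc_leibniz addrC; congr (_ + _).
  by rewrite -[X in st X](ract1 Gam) stE starK star1 lact1.
by rewrite (corep_col Uu); case: eqP; rewrite ?fodc_d1 // linear0.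
Qed.

Lemma dagger_scalar (phi : {scalar G}) : scalar (fun g => - conjC (phi (st g))).
Proof.
move=> k g g'; rewrite stA linearP /= rmorphD rmorphM /= conjCK opprD.
by rewrite mulrN.
Qed.

(** The sign makes up for the one in st_maurer_cartan, so that dagger phi o omega is
    the sharp of phi o omega. *)
Definition dagger phi := functional_of (dagger_scalar phi).

(** By haar_shift the adjoint of right convolution by phi o omega is right
    convolution by its sharp, and the involution of the calculus exhibits this
    operator as a contraction composed with d. *)
Lemma contract_adjoint phi b c :
  h (c^* * contract phi (d b)) = h ((contract (dagger phi) (d c))^* * b).
Proof.
elim/(cqg_ind HA): b => [|k x y hx hy|n u k l Uu].
- by rewrite linear0 contract0 !mulr0.
- by rewrite linearP contractP !mulrDr !linearD -!scalerAr !linearZ /= hx hy.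
elim/(cqg_ind HA): c => [|c x y hx hy|m v i j Uv].
- by rewrite linear0 contract0 star0 !mul0r.
- by rewrite linearP contractP !starP !mulrDl !linearD -!scalerAl !linearZ /= hx hy.
have omega_scalar : scalar (fun a => phi (omega a)).
  by move=> c x y; rewrite maurer_cartanP linearP.
rewrite -[d (u k l)](lact1 Gam) -[d (v i j)](lact1 Gam) !contract_entry // !mul1r.
have := congr1 (functional_of omega_scalar) (haar_shift hh Uu Uv i j k l).
rewrite !linear_sum /= => E.
transitivity (\sum_q h ((v i j)^* * u k q) * phi (omega (u q l))).
  rewrite mulr_sumr linear_sum; apply: eq_bigr => q _.
  by rewrite -scalerAr linearZ mulrC.
transitivity (\sum_q h ((v i q)^* * u k l) * phi (omega (v j q))).
  transitivity (\sum_q phi (omega (h ((v i j)^* * u k q) *: u q l))).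
    apply: eq_bigr => q _; rewrite -[_ *: u q l]addr0 maurer_cartanP.
    by rewrite maurer_cartan0 addr0 linearZ.
  rewrite E; apply: eq_bigr => q _; rewrite -[_ *: v j q]addr0 maurer_cartanP.
  by rewrite maurer_cartan0 addr0 linearZ.
rewrite star_sum mulr_suml linear_sum; apply: eq_bigr => q _.
rewrite starZ -scalerAl linearZ /= mulrC st_maurer_cartan // linearN /=.
by rewrite !rmorphN /= opprK conjCK.
Qed.

(** If the e i span the forms omega a with coordinates phi i, then they generate the
    calculus over A and the contractions are the coordinates. *)
Lemma contract_reconstruct r (e : 'I_r -> G) (phi : 'I_r -> {scalar G}) :
  (forall a, omega a = \sum_i phi i (omega a) *: e i) ->
  forall g, g = \sum_i contract (phi i) g ◃ e i.
Proof.
move=> oE; elim/fodc_ind => [|k g g' hg hg'|a b].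
- by rewrite big1 // => i _; rewrite contract0 lact0l.
- rewrite {1}hg {1}hg' scaler_sumr -big_split; apply: eq_bigr => i _.
  by rewrite contractP lactPl.
elim/(cqg_ind HA): b => [|k x y hx hy|n u q l Uu].
- by rewrite linear0 lact0r big1 // => i _; rewrite contract0 lact0l.
- rewrite linearP lactPr {1}hx {1}hy scaler_sumr -big_split; apply: eq_bigr => i _.
  by rewrite contractP lactPl.
rewrite {1}d_maurer_cartan // lact_sumr.
under [RHS]eq_bigr do rewrite contract_entry // lactM lact_suml lact_sumr.
rewrite exchange_big /=; apply: eq_bigr => p _.
rewrite {1}oE !lact_sumr; apply: eq_bigr => i _.
by rewrite lactZl !lactZr.
Qed.

Lemma comb_scalar (f f' : {scalar G}) k k' : scalar (fun g => k * f g + k' * f' g).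
Proof.
move=> c g g'; rewrite !linearP /= !mulrDr addrACA.
by rewrite (mulrCA c) (mulrCA c).
Qed.

Definition comb f f' k k' := functional_of (comb_scalar f f' k k').

Lemma contract_comb f f' k k' g :
  contract (comb f f' k k') g = k *: contract f g + k' *: contract f' g.
Proof.
rewrite /contract /tlift !scaler_sumr -big_split.
by apply: eq_bigr => p _; rewrite scalerDl !scalerA.
Qed.

Lemma eq_contract (f f' : {scalar G}) g : f =1 f' -> contract f g = contract f' g.
Proof. by move=> ff; apply: eq_bigr => p _; rewrite ff. Qed.

End LeftCoaction.

(** The contractions by a biorthogonal system of the left-invariant forms omega a
    separate the points of G.  Each functional phi of the system is replaced by the
    two functionals phi + dagger phi and 'i (phi - dagger phi), which dagger fixes:
    their contractions compose with d to symmetric operators, and phi is a linear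
    combination of them. *)
Theorem separating_contractions (h : {scalar A}) (hh : is_haar H h)
    (Gstar : is_star_calculus H Gam) (Gleft : finite_dim_left_covariant H Gam) :
  exists (I : finType) (T : I -> G -> A),
    [/\ forall i k g g', T i (k *: g + g') = k *: T i g + T i g',
        forall i a g, T i (a ◃ g) = a * T i g,
        forall i b c, h (c^* * T i (d b)) = h ((T i (d c))^* * b) &
        forall g, (forall i, T i g = 0) -> g = 0].
Proof.
have [st [stA stK stE]] := Gstar; have [DL [DLE [n [x [_ xspan]]]]] := Gleft.
have os : subspace (range omega).
  split; first by exists 0; rewrite // maurer_cartan0.
  by move=> k _ _ [a _ <-] [b _ <-]; exists (k *: a + b); rewrite // maurer_cartanP.
have [|r [e [phi [_ _ phiE]]]] := biorthogonal_system (x := x) os.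
  by move=> _ [a _ <-]; apply: xspan; exact: maurer_cartan_invariant.
pose dag i := dagger stA (phi i).
pose psi (ib : 'I_r * bool) := if ib.2 then comb (phi ib.1) (dag ib.1) 1 1
  else comb (phi ib.1) (dag ib.1) 'i (- 'i).
have psi_dag ib : dagger stA (psi ib) =1 psi ib.
  move=> g; case: ib => i [] /=; rewrite !stK.
    by rewrite !mul1r rmorphD rmorphN /= conjCK opprD opprK addrC.
  rewrite rmorphD !rmorphM /= rmorphN /= conjCi rmorphN /= conjCK.
  by rewrite opprK opprD !mulNr !mulrN !opprK addrC.
exists ('I_r * bool)%type, (fun ib => contract DL (psi ib)); split.
- by move=> ib k g g'; exact: contractP.
- by move=> ib a g; exact: contractM.
- move=> ib b c; rewrite (contract_adjoint DLE hh stA stE).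
  by rewrite (eq_contract _ _ (psi_dag ib)).
move=> g g0; rewrite (contract_reconstruct DLE (phi := phi) (e := e) _ g).
  rewrite big1 // => i _.
  suff -> : contract DL (phi i) g = 0 by rewrite lact0l.
  transitivity (contract DL (comb (psi (i, true)) (psi (i, false)) 2^-1 (- 'i / 2)) g).
    apply: eq_contract => y /=; rewrite !mul1r.
    have i2 : 'i * 'i = -1 :> C by rewrite -expr2 sqrCi.
    set p := phi i y; set q := - _.
    have -> : 2^-1 * (p + q) + - 'i / 2 * ('i * p + - 'i * q) =
        2^-1 * (p + q) - ('i * 'i) * 2^-1 * (p - q) by ring.
    by rewrite i2; field.
  by rewrite contract_comb !g0 !scaler0 addr0.
by move=> a; apply: phiE; exists a.
Qed.

End CovariantCalculus.

(** * The norm of an inner product *)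

Section InnerProduct.
Variables (C : numClosedFieldType) (U : lmodType C) (form : {dot U for conjC}).
Local Notation "'[ u , v ]" := (form u v).

Definition ipnorm (u : U) : C := sqrtC (form u u).

Lemma ipnorm_ge0 u : 0 <= ipnorm u.
Proof. by rewrite sqrtC_ge0 dnorm_ge0. Qed.

Lemma ipnormK u : ipnorm u ^+ 2 = form u u.
Proof. exact: sqrtCK. Qed.

Lemma ipnorm_eq0 u : ipnorm u = 0 -> u = 0.
Proof. by move/eqP; rewrite sqrtC_eq0 dnorm_eq0 => /eqP. Qed.

Lemma ipnorm0 : ipnorm 0 = 0.
Proof. by rewrite /ipnorm linear0l sqrtC0. Qed.

Lemma ipnormZ k u : ipnorm (k *: u) = `|k| * ipnorm u.
Proof.
rewrite /ipnorm dnormZ sqrtCM ?nnegrE ?exprn_ge0 ?dnorm_ge0 //.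
by rewrite sqrCK.
Qed.

Lemma cauchy_schwarz u v : `|form u v| <= ipnorm u * ipnorm v.
Proof.
have [->|v0] := eqVneq v 0.
  by rewrite linear0r normr0 mulr_ge0 ?ipnorm_ge0.
have fv : 0 < form v v by rewrite dnorm_gt0.
rewrite -(@ler_pXn2r _ 2) ?nnegrE ?mulr_ge0 ?ipnorm_ge0 ?normr_ge0 //.
rewrite exprMn !ipnormK -ler_pdivrMr // -subr_ge0.
set p := form u v; set q := form v v.
have qc : conjC q = q by rewrite conj_Creal // ger0_real // ltW.
have := dnorm_ge0 form (u - (p / q) *: v).
rewrite dnormB dnormZ linearZr_LR /= -/p -/q.
rewrite normrM exprMn normfV [`|q|](ger0_norm (ltW fv)).
rewrite rmorphM fmorphV /= qc.
have -> : conjC p / q * p = `|p| ^+ 2 / q by rewrite normCK mulrAC [conjC p * p]mulrC.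
rewrite rmorphM fmorphV /= qc rmorphXn /= [conjC `|p|]conj_Creal ?normr_real //.
set t := `|p| ^+ 2; congr (_ <= _).
by field; rewrite gt_eqF.
Qed.

Lemma ipnormD u v : ipnorm (u + v) <= ipnorm u + ipnorm v.
Proof.
rewrite -(@ler_pXn2r _ 2) ?nnegrE ?addr_ge0 ?ipnorm_ge0 //.
rewrite ipnormK dnormD sqrrD !ipnormK -[X in X <= _]ger0_norm; last first.
  by rewrite -dnormD dnorm_ge0.
rewrite (le_trans (ler_normD _ _)) // [X in _ <= X]addrAC.
rewrite lerD ?(le_trans (ler_normD _ _)) //.
  by rewrite !ger0_norm ?dnorm_ge0 // lerD.
by rewrite norm_conjC mulr2n lerD ?cauchy_schwarz.
Qed.

End InnerProduct.

(** * Complex sequences converging at rate 1/n *)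

Section RateLimits.
Variable R : realType.
Local Notation C := R[i].

Definition rate n : C := n.+1%:R^-1.

Lemma rate_gt0 n : 0 < rate n.
Proof. by rewrite invr_gt0 ltr0n. Qed.

Lemma rate_ge0 n : 0 <= rate n.
Proof. exact: ltW (rate_gt0 n). Qed.

Lemma rate_real n : rate n = (n.+1%:R^-1 : R)%:C%C.
Proof. by rewrite /rate fmorphV /= rmorph_nat. Qed.

Lemma rate_le1 n : rate n <= 1.
Proof. by rewrite invf_le1 ?ltr0n // ler1n. Qed.

Lemma rate_small (e : C) : 0 < e -> exists n, rate n < e.
Proof.
case: e => x y; rewrite ltcE /= => /andP[/eqP -> x0].
have [n nx] := ltr_add_invr x0; exists n.
by rewrite rate_real ltcR; rewrite add0r in nx.
Qed.

Lemma rate_contra (x K : C) : 0 < x -> ~ forall n, x <= K * rate n.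
Proof.
move=> x0 xK.
have K0 : 0 < K.
  by have := lt_le_trans x0 (xK 0%N); rewrite pmulr_lgt0 ?rate_gt0.
have [n nx] := rate_small (divr_gt0 x0 K0).
have := le_lt_trans (xK n); rewrite -(ltr_pM2l K0) in nx.
by move=> /(_ _ nx); rewrite mulrCA divff ?gt_eqF // mulr1 ltxx.
Qed.

Lemma rate_eq (x y K : C) : (forall n, `|x - y| <= K * rate n) -> x = y.
Proof.
move=> xy; apply/eqP; rewrite -subr_eq0 -normr_eq0; apply/negPn/negP => d0.
by apply: (@rate_contra `|x - y| K); rewrite // lt_neqAle eq_sym d0 normr_ge0.
Qed.

Lemma rate_le (x y K : C) : x \is Num.real -> y \is Num.real ->
  (forall n, x <= y + K * rate n) -> x <= y.
Proof.
move=> xr yr xy; rewrite real_leNgt //; apply/negP => yx.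
apply: (@rate_contra (x - y) K); first by rewrite subr_gt0.
by move=> n; rewrite lerBlDl.
Qed.

(** The intervals of radius k / n.+1 about a n intersect pairwise, so the supremum
    of their left ends lies in all of them. *)
Lemma real_rate_complete (a : nat -> R) k :
  (forall n m, `|a n - a m| <= k * (n.+1%:R^-1 + m.+1%:R^-1)) ->
  exists l, forall n, `|a n - l| <= k * n.+1%:R^-1.
Proof.
move=> ak; pose E := range (fun n => a n - k * n.+1%:R^-1).
have ubE m : ubound E (a m + k * m.+1%:R^-1).
  move=> _ [n _ <-]; rewrite lerBlDr -addrA -lerBlDl -mulrDr addrC.
  by rewrite (le_trans (ler_norm _)) // addrC [X in _ <= _ * X]addrC.
have Es : has_sup E.
  by split; [exists (a 0%N - k * 1%:R^-1), 0%N|exists (a 0%N + k * 1%:R^-1)].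
exists (sup E) => n; rewrite ler_distlC; apply/andP; split.
  by apply: sup_upper_bound => //; exists n.
by apply: ge_sup => //; case: Es.
Qed.

Lemma rate_complete (z : nat -> C) K :
  (forall n m, `|z n - z m| <= K * (rate n + rate m)) ->
  exists l, forall n, `|z n - l| <= K *+ 2 * rate n.
Proof.
move=> zK.
have [K0 KE] : 0 <= K /\ K = (complex.Re K)%:C%C.
  have : 0 <= K.
    have := zK 0%N 0%N; rewrite subrr normr0 pmulr_lge0 //.
    by rewrite addr_gt0 ?rate_gt0.
  by case: (K) => x y K0; split=> //; move: K0; rewrite lecE /= => /andP[/eqP -> _].
have normRe (w : C) : `|complex.Re w|%:C%C <= `|w| by exact: normc_ge_Re.
have normIm (w : C) : `|complex.Im w|%:C%C <= `|w|.
  by case: w => x y; rewrite normc_def lecR /= -sqrtr_sqr ler_wsqrtr // lerDr sqr_ge0.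
have [l1 l1P] : exists l, forall n, `|complex.Re (z n) - l| <= complex.Re K * n.+1%:R^-1.
  apply: real_rate_complete => n m.
  rewrite -lecR -raddfB /= (le_trans (normRe _)) // (le_trans (zK n m)) //.
  by rewrite {1}KE !rate_real rmorphM rmorphD.
have [l2 l2P] : exists l, forall n, `|complex.Im (z n) - l| <= complex.Re K * n.+1%:R^-1.
  apply: real_rate_complete => n m.
  rewrite -lecR -raddfB /= (le_trans (normIm _)) // (le_trans (zK n m)) //.
  by rewrite {1}KE !rate_real rmorphM rmorphD.
exists (l1 +i* l2)%C => n.
have -> : z n - (l1 +i* l2)%C =
    (complex.Re (z n) - l1)%:C%C + 'i%C * (complex.Im (z n) - l2)%:C%C.
  by case: (z n) => x y; simpc.
rewrite (le_trans (ler_normD _ _)) // normrM.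
have -> : `|'i%C| = 1 :> C by rewrite normc_def /= expr0n expr1n add0r sqrtr1.
rewrite mul1r mulr2n mulrDl KE rate_real -rmorphM /= !normc_def /=.
rewrite !expr0n /= !addr0 !sqrtr_sqr lerD ?lecR //.
Qed.

End RateLimits.

(** * Completion of an inner product space *)

Section Completion.
Variables (R : realType) (E : lmodType R[i]) (form : {dot E for (conjC : R[i] -> R[i])}).
Local Notation C := R[i].
Local Notation N := (ipnorm form).
Local Notation rate := (@rate R).

(** A bound by e on the dual norm of f - form x. *)
Definition approx (x : E) (f : E -> C^o) (e : C) :=
  forall y, `|f y - form x y| <= e * N y.

Lemma approxP k x x' f f' e e' : approx x f e -> approx x' f' e' ->
  approx (k *: x + x') (k *: f + f') (`|k| * e + e').
Proof.
move=> xf xf' y.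
have -> : (k *: f + f') y - form (k *: x + x') y =
    k * (f y - form x y) + (f' y - form x' y).
  by rewrite linearPl /= mulrBr opprD addrACA.
rewrite (le_trans (ler_normD _ _)) // mulrDl lerD // normrM -mulrA.
by rewrite ler_wpM2l.
Qed.

Lemma approx_dist x x' f e e' : 0 <= e + e' -> approx x f e -> approx x' f e' ->
  N (x - x') <= e + e'.
Proof.
move=> e0 xf xf'.
have [->|d0] := eqVneq (x - x') 0; first by rewrite ipnorm0.
have Nd : 0 < N (x - x').
  rewrite lt_neqAle ipnorm_ge0 andbT eq_sym; apply: contra_neq d0; exact: ipnorm_eq0.
rewrite -(ler_pM2r Nd) -expr2 ipnormK -[X in X <= _](ger0_norm (dnorm_ge0 _ _)).
rewrite {1}linearBl /= mulrDl.
have -> : form x (x - x') - form x' (x - x') =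
    (f (x - x') - form x' (x - x')) - (f (x - x') - form x (x - x')).
  by ring.
by rewrite (le_trans (ler_normB _ _)) // addrC lerD.
Qed.

Lemma approx_self x : approx x (form x) 0.
Proof. by move=> y; rewrite subrr normr0 mul0r. Qed.

(** The Hilbert space is the closure of E in its dual; being limits of inner products
    with vectors of E in the dual norm, its elements are antilinear and bounded.
    Functionals with the same values are equal, so this completion is formed
    without a quotient of Cauchy sequences. *)
Definition approximable : {pred E -> C^o} :=
  fun f => `[< forall e, 0 < e -> exists x, approx x f e >].

Definition represents (u : nat -> E) (f : E -> C^o) :=
  exists2 K : C, 0 <= K & forall n, approx (u n) f (K * rate n).

Lemma represents_exists f : f \in approximable -> exists u, represents u f.
Proof.
move=> /asboolP fa; have /choice[u uP] n := fa _ (@rate_gt0 R n).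
by exists u; exists 1; rewrite ?ler01 // => n; rewrite mul1r.
Qed.

Lemma represents_approximable u f : represents u f -> f \in approximable.
Proof.
move=> [K K0 uf]; apply/asboolP => e e0.
have [n nK] := rate_small (divr_gt0 e0 (ltr_wpDl K0 ltr01)).
exists (u n) => y; rewrite (le_trans (uf n y)) // ler_wpM2r ?ipnorm_ge0 //.
rewrite (@le_trans _ _ ((K + 1) * rate n)) //.
  by rewrite ler_wpM2r ?rate_ge0 // lerDl ler01.
by rewrite mulrC -ler_pdivlMr ?(ltW nK) // ltr_wpDl.
Qed.

Lemma representsP k u u' f f' : represents u f -> represents u' f' ->
  represents (fun n => k *: u n + u' n) (k *: f + f').
Proof.
move=> [K K0 uf] [K' K0' uf']; exists (`|k| * K + K').
  by rewrite addr_ge0 // mulr_ge0.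
by move=> n; rewrite mulrDl -mulrA; apply: approxP.
Qed.

Lemma represents_self x : represents (fun=> x) (form x).
Proof. by exists 0 => // n; rewrite mul0r; exact: approx_self. Qed.

(** Closeness of functionals in the dual norm bounds distances in E, see
    approx_dist; hence all sequences that represent f are Cauchy with an explicit
    rate and approach each other. *)
Lemma represents_dist u u' f : represents u f -> represents u' f ->
  exists2 K, 0 <= K & forall n m, N (u n - u' m) <= K * (rate n + rate m).
Proof.
move=> [K K0 uf] [K' K0' uf']; exists (K + K'); first exact: addr_ge0.
have pos n m : 0 <= K * rate n + K' * rate m.
  by rewrite addr_ge0 // mulr_ge0 ?rate_ge0.
move=> n m; rewrite (le_trans (approx_dist (pos n m) (uf n) (uf' m))) //.
by rewrite mulrDr !mulrDl lerD // ?lerDl ?lerDr mulr_ge0 ?rate_ge0.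
Qed.

Lemma represents_bound u f : represents u f ->
  exists2 M, 0 <= M & forall n, N (u n) <= M.
Proof.
move=> uf; have [K K0 uK] := represents_dist uf uf.
exists (K * 2 + N (u 0%N)); first by rewrite addr_ge0 ?ipnorm_ge0 // mulr_ge0.
move=> n; rewrite -{1}(subrK (u 0%N) (u n)) (le_trans (ipnormD _ _ _)) // lerD //.
by rewrite (le_trans (uK n 0%N)) // ler_wpM2l // -[2]/(1 + 1) lerD ?rate_le1.
Qed.

Lemma form_dist u u' w w' f g :
  represents u f -> represents u' f -> represents w g -> represents w' g ->
  exists K, forall n m, `|form (u n) (w n) - form (u' m) (w' m)| <= K * (rate n + rate m).
Proof.
move=> uf uf' wg wg'.
have [K K0 uK] := represents_dist uf uf'; have [L L0 wL] := represents_dist wg wg'.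
have [M M0 uM] := represents_bound uf'; have [P P0 wP] := represents_bound wg.
exists (K * P + M * L) => n m.
have -> : form (u n) (w n) - form (u' m) (w' m) =
    form (u n - u' m) (w n) + form (u' m) (w n - w' m).
  by rewrite linearBl linearBr /= addrA subrK.
rewrite (le_trans (ler_normD _ _)) // mulrDl lerD //.
  rewrite (le_trans (cauchy_schwarz _ _ _)) // mulrAC.
  by rewrite ler_pM ?ipnorm_ge0.
rewrite (le_trans (cauchy_schwarz _ _ _)) // -mulrA.
by rewrite ler_pM ?ipnorm_ge0.
Qed.

Definition rate_cvg (z : nat -> C) l := exists K, forall n, `|z n - l| <= K * rate n.

Lemma rate_cvg_unique z l l' : rate_cvg z l -> rate_cvg z l' -> l = l'.
Proof.
move=> [K zl] [K' zl']; apply: (@rate_eq _ _ _ (K + K')) => n.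
have -> : l - l' = (z n - l') - (z n - l) by ring.
by rewrite (le_trans (ler_normB _ _)) // addrC mulrDl lerD.
Qed.

Lemma rate_cvgP k z z' l l' : rate_cvg z l -> rate_cvg z' l' ->
  rate_cvg (fun n => k * z n + z' n) (k * l + l').
Proof.
move=> [K zl] [K' zl']; exists (`|k| * K + K') => n.
rewrite opprD addrACA -mulrBr (le_trans (ler_normD _ _)) // mulrDl lerD //.
by rewrite normrM -mulrA ler_wpM2l.
Qed.

Lemma rate_cvg_conj z l : rate_cvg z l -> rate_cvg (fun n => conjC (z n)) (conjC l).
Proof. by move=> [K zl]; exists K => n; rewrite -rmorphB norm_conjC. Qed.

Lemma rate_cvg_le z l B K : (forall n, z n \is Num.real) -> B \is Num.real ->
  rate_cvg z l -> (forall n, z n <= B + K * rate n) -> l <= B.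
Proof.
move=> zr Br zl zB.
have lr : l \is Num.real.
  apply/CrealP; apply: rate_cvg_unique (zl).
  have := rate_cvg_conj zl; congr rate_cvg; apply/funext => n.
  by rewrite conj_Creal.
have [K' zK] := zl; apply: (@rate_le _ _ _ (K + K')) => // n.
rewrite mulrDl addrA -lerBlDr (le_trans _ (zB n)) // lerBlDr -lerBlDl.
by rewrite (le_trans (real_ler_norm _)) ?realB // distrC.
Qed.

Lemma rate_cvg_ge0 z l : (forall n, 0 <= z n) -> rate_cvg z l -> 0 <= l.
Proof.
move=> z0 zl; rewrite -oppr_le0.
have zl' : rate_cvg (fun n => - z n) (- l).
  have zero : rate_cvg (fun=> 0) 0 by exists 0 => n; rewrite subrr normr0 mul0r.
  have := rate_cvgP (-1) zl zero; rewrite mulN1r addr0.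
  by congr rate_cvg; apply/funext => n; rewrite mulN1r addr0.
apply: (@rate_cvg_le _ _ _ 0 _ _ zl') => // n.
  by rewrite realN ger0_real.
by rewrite mul0r addr0 oppr_le0.
Qed.

Lemma approximable_submod : submod_closed approximable.
Proof.
split.
  apply: (@represents_approximable (fun=> 0)); exists 0 => // n y.
  by rewrite mul0r linear0l subrr normr0 mul0r.
move=> k f g /represents_exists[u uf] /represents_exists[w wg].
exact: represents_approximable (representsP k uf wg).
Qed.

HB.instance Definition _ :=
  GRing.isSubmodClosed.Build C (E -> C^o) approximable approximable_submod.
Definition completion := {f : E -> C^o | f \in approximable}.
HB.instance Definition _ := SubType.on completion.
HB.instance Definition _ := Choice.on completion.
HB.instance Definition _ := [SubChoice_isSubLmodule of completion by <:].

Lemma completion_ip_exists (f g : completion) : exists l,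
  forall u w, represents u (val f) -> represents w (val g) ->
    rate_cvg (fun n => form (u n) (w n)) l.
Proof.
have [u uf] := represents_exists (valP f); have [w wg] := represents_exists (valP g).
have [K KP] := form_dist uf uf wg wg.
have [l lP] := rate_complete KP.
exists l => u' w' uf' wg'; have [L LP] := form_dist uf' uf wg' wg.
exists (L * 2 + K *+ 2) => n.
have -> : form (u' n) (w' n) - l =
  (form (u' n) (w' n) - form (u n) (w n)) + (form (u n) (w n) - l).
  by rewrite addrA subrK.
rewrite (le_trans (ler_normD _ _)) // mulrDl lerD // -mulrA.
by rewrite (le_trans (LP n n)) // -mulr2n mulr_natl.
Qed.

Definition completion_ip f g : C := projT1 (cid (completion_ip_exists f g)).

Lemma completion_ipP f g u w : represents u (val f) -> represents w (val g) ->
  rate_cvg (fun n => form (u n) (w n)) (completion_ip f g).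
Proof. by rewrite /completion_ip; case: cid => l lP; exact: lP. Qed.

Lemma completion_ip_linear g : scalar (completion_ip^~ g).
Proof.
move=> k f f'.
have [u uf] := represents_exists (valP f); have [u' uf'] := represents_exists (valP f').
have [w wg] := represents_exists (valP g).
have ufk : represents (fun n => k *: u n + u' n) (val (k *: f + f')).
  exact: representsP.
apply: rate_cvg_unique (completion_ipP ufk wg) _.
have := rate_cvgP k (completion_ipP uf wg) (completion_ipP uf' wg).
by congr rate_cvg; apply/funext => n; rewrite linearPl.
Qed.

Lemma completion_ip_herm f g : completion_ip f g = conjC (completion_ip g f).
Proof.
have [u uf] := represents_exists (valP f); have [w wg] := represents_exists (valP g).
apply: rate_cvg_unique (completion_ipP uf wg) _.
have := rate_cvg_conj (completion_ipP wg uf).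
congr rate_cvg; apply/funext => n.
by rewrite [RHS](@hermitian_subproof _ _ false) expr0 mul1r.
Qed.

(** If the value at f is 0, then the squared norms of a representing sequence tend
    to 0 at the given rate, and by the Cauchy-Schwarz inequality so does the square
    of its inner product with y, whose limit is f y. *)
Lemma completion_ip_gt0 f : f != 0 -> 0 < completion_ip f f.
Proof.
move=> f0; have [u uf] := represents_exists (valP f).
have ff := completion_ipP uf uf.
have ge0 : 0 <= completion_ip f f.
  by apply: rate_cvg_ge0 ff => n; exact: dnorm_ge0.
rewrite lt_neqAle ge0 andbT eq_sym; apply: contra_neq f0 => ff0.
rewrite ff0 in ff; have [L LP] := ff; have [K K0 uK] := uf.
apply/val_inj/funext => y /=.
have L0 : 0 <= L.
  by have := le_trans (normr_ge0 _) (LP 0%N); rewrite pmulr_lge0 ?rate_gt0.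
suff : `|val f y| ^+ 2 = 0 by move/eqP; rewrite expf_eq0 /= normr_eq0 => /eqP.
apply: (@rate_eq _ _ _ (2 * (K ^+ 2 + L) * N y ^+ 2)) => n.
rewrite subr0 ger0_norm ?exprn_ge0 //.
have le1 : `|val f y| <= K * rate n * N y + N (u n) * N y.
  rewrite -(subrK (form (u n) y) (val f y)) (le_trans (ler_normD _ _)) // lerD //.
    exact: uK.
  exact: cauchy_schwarz.
have pos1 : 0 <= K * rate n by rewrite mulr_ge0 ?rate_ge0.
(* Only the square of N (u n) is known to decay like the rate, so the bound is squared. *)
rewrite (le_trans (_ : _ <= ((K * rate n + N (u n)) * N y) ^+ 2)) //.
  by rewrite lerXn2r ?nnegrE ?mulr_ge0 ?addr_ge0 ?ipnorm_ge0 ?mulrDl.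
rewrite exprMn [_ * N y ^+ 2 * rate n]mulrAC ler_wpM2r ?exprn_ge0 ?ipnorm_ge0 //.
have sq (a b : C) : 0 <= a -> 0 <= b -> (a + b) ^+ 2 <= 2 * (a ^+ 2 + b ^+ 2).
  move=> a0 b0; rewrite -subr_ge0.
  have -> : 2 * (a ^+ 2 + b ^+ 2) - (a + b) ^+ 2 = (a - b) ^+ 2 by ring.
  by rewrite real_exprn_even_ge0 // realB ?ger0_real.
rewrite (le_trans (sq _ _ _ _)) ?ipnorm_ge0 // -mulrA ler_wpM2l //.
rewrite mulrDl lerD //.
  by rewrite exprMn ler_wpM2l ?exprn_ge0 // expr2 ler_piMl ?rate_ge0 ?rate_le1.
rewrite ipnormK -[X in X <= _](ger0_norm (dnorm_ge0 _ _)).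
by have := LP n; rewrite subr0.
Qed.

End Completion.

Section CompletionSpace.
Variables (R : realType) (E : lmodType R[i]) (form : {dot E for (conjC : R[i] -> R[i])}).
Local Notation C := R[i].
Local Notation N := (ipnorm form).
Local Notation rate := (@rate R).
Local Notation V := (completion form).

Lemma completion_ip_bilinear : bilinear_for
  (GRing.Scale.Law.clone _ _ ( *%R ) _) (GRing.Scale.Law.clone _ _ (conjC \; *%R ) _)
  (@completion_ip R E form).
Proof.
split=> [g|g] k f f' /=; first exact: completion_ip_linear.
rewrite completion_ip_herm completion_ip_linear rmorphD rmorphM /=.
by rewrite -!completion_ip_herm.
Qed.

HB.instance Definition _ := bilinear_isBilinear.Build C V V C
  (GRing.Scale.Law.clone _ _ ( *%R ) _) (GRing.Scale.Law.clone _ _ (conjC \; *%R ) _)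
  (@completion_ip R E form) completion_ip_bilinear.

Lemma completion_ip_hermitian (f g : V) :
  completion_ip f g = (-1) ^+ false * conjC (completion_ip g f).
Proof. by rewrite expr0 mul1r; exact: completion_ip_herm. Qed.

HB.instance Definition _ := isHermitianSesquilinear.Build C V false conjC
  (@completion_ip R E form) completion_ip_hermitian.

HB.instance Definition _ := isDotProduct.Build C V (@completion_ip R E form)
  (@completion_ip_gt0 R E form).

Definition cdot : {dot V for (conjC : C -> C)} := @completion_ip R E form.

HB.instance Definition _ := Lmodule_isNormed.Build C V
  (ipnormD cdot) (ipnormZ cdot) (@ipnorm_eq0 _ _ cdot).

Lemma completion_normE (f : V) : `|f| = ipnorm cdot f.
Proof. by []. Qed.

Lemma embed_subproof x : (form x : E -> C^o) \in approximable form.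
Proof. exact: represents_approximable (represents_self form x). Qed.

Definition embed (x : E) : V := exist _ (form x : E -> C^o) (embed_subproof x).

Lemma embed_linear : linear embed.
Proof.
move=> k x y; apply: val_inj; apply/funext => z.
by rewrite [LHS]linearPl linearP.
Qed.

HB.instance Definition _ := GRing.isLinear.Build C E V *:%R embed embed_linear.

Lemma cdot_embed x y : cdot (embed x) (embed y) = form x y.
Proof.
apply: rate_cvg_unique (completion_ipP (f := embed x) (g := embed y)
  (represents_self form x) (represents_self form y)) _.
by exists 0 => n; rewrite subrr normr0 mul0r.
Qed.

Lemma norm_embed x : `|embed x| = N x.
Proof. by rewrite completion_normE /ipnorm cdot_embed. Qed.

(** The norm of the completion is at most the dual norm: a sequence that represents
    g has norms at most e, up to its rate. *)
Lemma norm_approx x f e : 0 <= e -> approx form x (val f) e -> `|f - embed x| <= e.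
Proof.
move=> e0 xf; set g := f - embed x.
have ga : approx form 0 (val g) e.
  by move=> y; rewrite linear0l subr0; exact: xf.
have [u ug] := represents_exists (valP g); have [K K0 uK] := ug.
have uN n : N (u n) <= K * rate n + e.
  have Kr : 0 <= K * rate n by rewrite mulr_ge0 ?rate_ge0.
  by have := approx_dist (addr_ge0 Kr e0) (uK n) ga; rewrite subr0.
rewrite completion_normE -(@ler_pXn2r _ 2) ?nnegrE ?ipnorm_ge0 // ipnormK.
apply: (@rate_cvg_le _ _ _ _ (K ^+ 2 + 2 * K * e) _ _ (completion_ipP ug ug)).
- by move=> n; rewrite ger0_real ?dnorm_ge0.
- by rewrite ger0_real ?exprn_ge0.
move=> n; rewrite -ipnormK (le_trans (_ : _ <= (K * rate n + e) ^+ 2)) //.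
  by rewrite lerXn2r ?nnegrE ?addr_ge0 ?ipnorm_ge0 ?mulr_ge0 ?rate_ge0.
have -> : (K * rate n + e) ^+ 2 = e ^+ 2 + (K ^+ 2 * rate n ^+ 2 + 2 * K * e * rate n).
  by ring.
rewrite lerD2l [leRHS]mulrDl lerD2r ler_wpM2l ?exprn_ge0 //.
by rewrite expr2 ler_piMl ?rate_ge0 ?rate_le1.
Qed.

Lemma embed_dense_dist (f : V) e : 0 < e -> exists x, `|f - embed x| <= e.
Proof.
move=> e0; have /asboolP/(_ e e0)[x xf] := valP f; exists x => //.
by apply: norm_approx; rewrite ?ltW.
Qed.

(** Balls of radius rate n that belong to the filter are centred at points f n; these
    are replaced by points x n of E at distance at most rate n.  The inner products
    with the x n converge at a uniform rate, and their limit is a point of the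
    completion. *)
Lemma completion_complete (F : set_system V) : ProperFilter F -> cauchy F -> cvg F.
Proof.
move=> FF /cauchyP Fc.
have /choice[f fP] n := Fc _ (@rate_gt0 R n).
have /choice[x xP] n : exists x, `|f n - embed x| <= rate n.
  by exact: embed_dense_dist (@rate_gt0 R n).
have xN n m : N (x n - x m) <= 2 * (rate n + rate m).
  have [g []] := filter_ex (filterI (fP n) (fP m)).
  rewrite -ball_normE /= => gn gm.
  rewrite -norm_embed linearB /=.
  rewrite (le_trans (ler_distD g _ _)) // mulrDr lerD //.
    rewrite (le_trans (ler_distD (f n) _ _)) // mulr_natl mulr2n lerD //.
      by rewrite distrC.
    exact: ltW.
  rewrite (le_trans (ler_distD (f m) _ _)) // mulr_natl mulr2n lerD //.
  by rewrite distrC ltW.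
have /choice[l lP] y : exists l, forall n, `|form (x n) y - l| <= (2 * N y) *+ 2 * rate n.
  apply: rate_complete => n m; rewrite -linearBl mulrAC.
  by rewrite (le_trans (cauchy_schwarz _ _ _)) // ler_wpM2r ?ipnorm_ge0.
have lx : represents form x (l : E -> C^o).
  exists (2 *+ 2) => [|n y]; first by rewrite mulrn_wge0.
  by rewrite distrC (le_trans (lP y n)) // -mulrnAl mulrAC.
pose g : V := exist _ (l : E -> C^o) (represents_approximable lx).
have gx n : `|g - embed (x n)| <= 2 *+ 2 * rate n.
  apply: norm_approx; first by rewrite mulr_ge0 ?rate_ge0 // mulrn_wge0.
  by move=> y; rewrite /= distrC (le_trans (lP y n)) // -mulrnAl mulrAC.
apply/cvg_ex; exists g; apply/cvg_ballP => e e0.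
have [n nP] := rate_small (divr_gt0 e0 (ltr0Sn C 5)).
apply: filterS (fP n) => h; rewrite -!ball_normE /= => hn.
rewrite (@le_lt_trans _ _ (6 * rate n)) //; last by rewrite mulrC -ltr_pdivlMr ?ltr0Sn.
have -> : 6 * rate n = 2 *+ 2 * rate n + (rate n + rate n) by ring.
rewrite (le_trans (ler_distD (embed (x n)) _ _)) // lerD ?gx //.
rewrite (le_trans (ler_distD (f n) _ _)) // lerD //; first by rewrite distrC.
exact: ltW.
Qed.

HB.instance Definition _ := Uniform_isComplete.Build V completion_complete.

Lemma embed_dense : dense (range embed).
Proof.
move=> O [f Of] Oo.
have /nbhs_ballP[e /= e0 eO] : nbhs f O by apply: open_nbhs_nbhs.
have e2 : 0 < e / 2 by rewrite divr_gt0 ?ltr0n.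
have [x fx] := embed_dense_dist f e2.
exists (embed x); split; last by exists x.
apply: eO; rewrite -ball_normE /=; apply: le_lt_trans fx _.
by rewrite ltr_pdivrMr ?ltr0n // ltr_pMr // ltr1n.
Qed.

End CompletionSpace.

Theorem hilbert_completion (R : realType) (E : lmodType R[i])
    (form : {dot E for (conjC : R[i] -> R[i])}) :
  exists (V : completeNormedModType R[i]) (ip : {dot V for Num.conj})
      (iota : {linear E -> V}),
    [/\ is_hilbert ip, dense (range iota) & forall x y, ip (iota x) (iota y) = form x y].
Proof.
exists (completion form), (cdot form), (@embed R E form); split.
- by move=> x; rewrite completion_normE ipnormK.
- exact: embed_dense.
- exact: cdot_embed.
Qed.

(** * Operators on a dense domain *)

Section DenseDomain.
Variables (C : numClosedFieldType) (V : completeNormedModType C) (E : lmodType C).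
Variables (iota : {linear E -> V}).

Definition range_pred : {pred V} := fun v => `[< range iota v >].

Lemma range_submod : submod_closed range_pred.
Proof.
split; first by apply/asboolP; exists 0; rewrite // linear0.
move=> k _ _ /asboolP[x _ <-] /asboolP[y _ <-].
by apply/asboolP; exists (k *: x + y); rewrite // linearP.
Qed.

HB.instance Definition _ := GRing.isSubmodClosed.Build C V range_pred range_submod.

Definition range_dom : submodClosed V := range_pred.

Lemma range_dom_subproof x : iota x \in range_dom.
Proof. by apply/asboolP; exists x. Qed.

Definition to_dom (x : E) : dom range_dom := exist _ (iota x) (range_dom_subproof x).

Lemma of_dom_subproof (v : dom range_dom) : exists x, iota x = val v.
Proof. by have /asboolP[x _ <-] := valP v; exists x. Qed.

Definition of_dom v : E := projT1 (cid (of_dom_subproof v)).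

Lemma iota_of_dom v : iota (of_dom v) = val v.
Proof. by rewrite /of_dom; case: cid. Qed.

Hypothesis iota_inj : injective iota.

Lemma val_domP k (u v : dom range_dom) : val (k *: u + v) = k *: val u + val v.
Proof. by []. Qed.

Lemma val_domZ k (u : dom range_dom) : val (k *: u) = k *: val u.
Proof. by []. Qed.

Lemma to_domK : cancel to_dom of_dom.
Proof. by move=> x; apply: iota_inj; rewrite iota_of_dom. Qed.

Lemma of_dom_linear : linear of_dom.
Proof. by move=> k u v; apply: iota_inj; rewrite linearP !iota_of_dom linearP. Qed.

Lemma to_dom_linear : linear to_dom.
Proof. by move=> k u v; apply: val_inj; rewrite /= !linearP. Qed.

Lemma transport_linear (T : E -> E) : linear T -> linear (to_dom \o T \o of_dom).
Proof. by move=> TL k u v; rewrite /= of_dom_linear TL to_dom_linear. Qed.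

Definition transport (T : E -> E) (TL : linear T) :
    {linear dom range_dom -> dom range_dom} :=
  HB.pack (to_dom \o T \o of_dom) (GRing.isLinear.Build C _ _ *:%R
    (to_dom \o T \o of_dom) (transport_linear TL)).

Lemma val_transport T (TL : linear T) v : val (transport TL v) = iota (T (of_dom v)).
Proof. by []. Qed.

Lemma of_dom_transport T (TL : linear T) v : of_dom (transport TL v) = T (of_dom v).
Proof. exact: to_domK. Qed.

Lemma of_domB u v : of_dom (u - v) = of_dom u - of_dom v.
Proof.
have -> : u - v = -1 *: v + u by rewrite scaleN1r addrC.
by rewrite of_dom_linear scaleN1r addrC.
Qed.

End DenseDomain.

(** * The commutator representation *)

Theorem corollary3 (R : realType) (A : algType R[i])
    (H : hopf_star_algebra A) (HA : is_CQG H)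
    (G : lmodType R[i]) (Gam : fodc A G)
    (Gstar : is_star_calculus H Gam)
    (Gleft : finite_dim_left_covariant H Gam) :
  exists (V : completeNormedModType R[i]) (ip : {dot V for Num.conj})
         (D : submodClosed V)
         (rep : A -> {linear dom D -> dom D}) (F : {linear dom D -> dom D}),
    [/\ is_hilbert ip,
        dense [set x : V | x \in D],
        is_star_rep ip H rep,
        symmetric_op ip F &
        faithful_commutator_rep Gam rep F].
Proof.
have [h hh] := haar_functional_exists HA.
have [I [T [TP TM Tsym Tsep]]] := separating_contractions HA hh Gstar Gleft.
pose E : lmodType R[i] := {ffun I -> A}.
pose b (x y : E) : R[i] := \sum_i h (star H (y i) * x i).
have b_bil : bilinear_for (GRing.Scale.Law.clone _ _ ( *%R ) _)
    (GRing.Scale.Law.clone _ _ (Num.conj \; *%R ) _) b.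
  split=> [y|x] k u v; rewrite /b /= mulr_sumr -big_split; apply: eq_bigr => i _ /=.
    by rewrite !ffunE mulrDr -scalerAr linearP.
  by rewrite !ffunE starP mulrDl -scalerAl linearP.
have b_herm x y : b x y = (-1) ^+ false * Num.conj (b y x).
  rewrite expr0 mul1r /b rmorph_sum; apply: eq_bigr => i _.
  by rewrite /= -(haar_star hh) starM starK.
have b_pos x : x != 0 -> 0 < b x x.
  move=> x0; have pos a : 0 <= h (star H a * a).
    have [->|a0] := eqVneq a 0; first by rewrite mulr0 linear0.
    by rewrite ltW // (haar_positive HA hh).
  rewrite lt_neqAle sumr_ge0 // andbT eq_sym; apply: contra_neq x0 => bx0.
  apply/ffunP => i; rewrite ffunE; apply/eqP/negPn/negP => xi0.
  move/eqP: bx0; rewrite psumr_eq0 // => /allP/(_ i (mem_index_enum _)) /=.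
  by rewrite gt_eqF // (haar_positive HA hh).
(* The sum of the forms h (star c * b) over the copies of A. *)
pose form : {dot E for (Num.conj : R[i] -> R[i])} := HB.pack b
  (bilinear_isBilinear.Build R[i] E E R[i] _ _ b b_bil)
  (isHermitianSesquilinear.Build R[i] E false Num.conj b b_herm)
  (isDotProduct.Build R[i] E b b_pos).
have [V [ip [iota [Vh Vd Viso]]]] := hilbert_completion form.
have iinj : injective iota.
  move=> x y xy; apply/eqP; rewrite -subr_eq0; apply/negPn/negP => /b_pos.
  by rewrite -[b _ _]/(form (x - y) (x - y)) -Viso raddfB /= xy subrr linear0l ltxx.
have repL a : linear (fun x : E => [ffun i => a * x i] : E).
  by move=> k x y; apply/ffunP => i; rewrite !ffunE mulrDr -scalerAr.
have FL : linear (fun x : E => [ffun i => T i (fodc_d Gam (x i))] : E).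
  by move=> k x y; apply/ffunP => i; rewrite !ffunE linearP TP.
have tauL g : linear (fun x : E => [ffun i => 'i *: T i (ract Gam g (x i))] : E).
  move=> k x y; apply/ffunP => i; rewrite !ffunE linearPr TP scalerDr.
  by rewrite !scalerA mulrC.
pose rep a := transport iinj (repL a).
pose F := transport iinj FL.
pose tau g := transport iinj (tauL g).
have valE (f : E -> E) (fL : linear f) (x y : dom (range_dom iota)) :
    ip (val (transport iinj fL x)) (val y) = b (f (of_dom x)) (of_dom y).
  by rewrite val_transport -[val y]iota_of_dom Viso.
have valEr (f : E -> E) (fL : linear f) (x y : dom (range_dom iota)) :
    ip (val x) (val (transport iinj fL y)) = b (of_dom x) (f (of_dom y)).
  by rewrite val_transport -[val x]iota_of_dom Viso.
exists V, ip, (range_dom iota), rep, F; split=> //.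
- have -> // : [set x | x \in range_dom iota] = range iota.
  by apply/seteqP; split=> x; [move/asboolP|move=> ?; apply/asboolP].
- split.
  + move=> k a c x; apply: val_inj; rewrite val_domP !val_transport -linearP.
    congr (iota _); apply/ffunP => i; rewrite !ffunE.
    by rewrite mulrDl -scalerAl.
  + move=> x; apply: val_inj; rewrite val_transport -[RHS]iota_of_dom.
    by congr (iota _); apply/ffunP => i; rewrite ffunE mul1r.
  + move=> a c x; apply: val_inj; rewrite !val_transport to_domK //.
    by congr (iota _); apply/ffunP => i; rewrite !ffunE mulrA.
  + move=> a x y; rewrite valE valEr; apply: eq_bigr => i _.
    by rewrite !ffunE starM starK mulrA.
- by move=> x y; rewrite valE valEr; apply: eq_bigr => i _; rewrite !ffunE Tsym.
exists tau; split; first split.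
- move=> k g g' x; apply: val_inj; rewrite val_domP !val_transport -linearP.
  congr (iota _); apply/ffunP => i; rewrite !ffunE linearPl TP scalerDr.
  by rewrite !scalerA mulrC.
- move=> a c x; apply: val_inj; rewrite val_domZ !val_transport -linearZ.
  rewrite /rep /F (of_domB iinj) !(of_dom_transport iinj); congr (iota _); apply/ffunP => i.
  rewrite !ffunE; congr (_ *: _).
  (* The Leibniz rule cancels the terms c (T dx) and leaves T (dc x). *)
  rewrite fodc_leibniz -[X in T i (X + _)]scale1r TP scale1r TM.
  by rewrite [c * _ + _]addrC addrK -TM lractA.
move=> g g' gg'; apply/eqP; rewrite -subr_eq0; apply/eqP/Tsep => i.
(* At the constant vector 1 the operators return T i g and T i g'. *)
have /(congr1 val) := gg' (to_dom iota [ffun=> 1]).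
rewrite !val_transport => /iinj/ffunP/(_ i).
rewrite to_domK // !ffunE !ract1 => /(scalerI (neq0Ci _)) E0.
by rewrite addrC -scaleN1r TP E0 scaleN1r addNr.
Qed.
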